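(* Let $X$ be a real random variable and let $Z\sim N(0,1)$ be independent of $X$. For $0\leq t\leq 1$ put $X_t=\sqrt{t}\,X+\sqrt{1-t}\,Z$. If $\chi^2(X,Z)<\infty$, then, for all $t\in[0,1]$, $$\chi^2(X_t,Z)=\sum_{k=1}^\infty\frac{t^k}{k!}\,\big(\mathbb{E}H_k(X)\big)^2.$$
   Context: $H_k(x)=(-1)^k(e^{-x^2/2})^{(k)}e^{x^2/2}$ is the $k$-th Chebyshev–Hermite polynomial. With $\varphi(x)=\frac{1}{\sqrt{2\pi}}e^{-x^2/2}$, for a random variable $Y$ with density $p$, $\chi^2(Y,Z)=\int_{-\infty}^\infty\frac{p(x)^2}{\varphi(x)}\,dx-1\in[0,\infty]$ (depending only on the law of $Y$); if $Y$ has no density, then $\chi^2(Y,Z)=\infty$. Finiteness of $\chi^2(X,Z)$ implies that $X$ has finite moments of all orders. *)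

(* Defs.v *)
From HB Require Import structures.
From mathcomp Require Import all_boot all_order all_algebra.
From mathcomp Require Import all_classical all_reals all_analysis.
From mathcomp Require Import measurable_realfun.

Set Implicit Arguments.
Unset Strict Implicit.
Unset Printing Implicit Defensive.

Import Order.TTheory GRing.Theory Num.Theory.
Import numFieldNormedType.Exports.

Local Open Scope classical_set_scope.
Local Open Scope ring_scope.

Definition hermite (R : realType) (k : nat) (x : R) : R :=
  (-1) ^+ k * (fun y : R => expR (- (y ^+ 2 / 2)))^`(k)%classic x *
    expR (x ^+ 2 / 2).

Section random_variables.
Context d (T : measurableType d) (R : realType) (P : probability T R).

(* The equality of laws is required on measurable sets only: the values of a
   measure on non-measurable sets carry no meaning. *)
Definition standard_normal (Z : {RV P >-> R}) : Prop :=
  forall A : set R, measurable A -> distribution P Z A = normal_prob 0 1 A.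

Definition independent_RV (X Y : {RV P >-> R}) : Prop :=
  forall A B : set R, measurable A -> measurable B ->
    P (X @^-1` A `&` Y @^-1` B) = (P (X @^-1` A) * P (Y @^-1` B))%E.

Definition is_density (Y : {RV P >-> R}) (p : R -> R) : Prop :=
  [/\ measurable_fun setT p,
      forall x, 0 <= p x &
      forall A : set R, measurable A ->
        distribution P Y A = (\int[lebesgue_measure]_(x in A) (p x)%:E)%E].

(* The chi-square divergence of the law of Y from N(0, 1). The value does not
   depend on the chosen density: see chi2_normalE. *)
Definition chi2_normal (Y : {RV P >-> R}) : \bar R :=
  match pselect (exists p, is_density Y p) with
  | left Yp =>
      let p := sval (cid Yp) in
      (\int[lebesgue_measure]_x (p x ^+ 2 / normal_pdf 0 1 x)%:E - 1)%E
  | right _ => +oo%E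
  end.

End random_variables.

Arguments standard_normal {d T R} P Z.
Arguments independent_RV {d T R} P X Y.
Arguments is_density {d T R} P Y p.
Arguments chi2_normal {d T R} P Y.

Section density.
Context d (T : measurableType d) (R : realType) (P : probability T R).

Lemma is_density_ae_eq (Y : {RV P >-> R}) (p q : R -> R) :
  is_density P Y p -> is_density P Y q ->
  ae_eq lebesgue_measure setT (EFin \o p) (EFin \o q).
Proof.
move=> [mp p0 pE] [mq q0 qE].
apply: integral_ae_eq => //=.
- apply/integrableP; split; first exact/measurable_EFinP.
  under eq_integral do rewrite /= ger0_norm//.
  by rewrite -pE// probability_setT ltry.
- exact/measurable_EFinP.
- by move=> A _ mA; rewrite -pE// -qE.
Qed.

Lemma chi2_normalE (Y : {RV P >-> R}) (p : R -> R) : is_density P Y p ->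
  chi2_normal P Y =
  (\int[lebesgue_measure]_x (p x ^+ 2 / normal_pdf 0 1 x)%:E - 1)%E.
Proof.
move=> Yp; rewrite /chi2_normal; case: pselect => [h|]; last by case; exists p.
case: (cid h) => q /= Yq; congr (_ - 1)%E.
have mf (r : R -> R) : is_density P Y r ->
    measurable_fun setT (fun x => (r x ^+ 2 / normal_pdf 0 1 x)%:E).
  move=> [mr _ _]; apply/measurable_EFinP; apply: measurable_funM.
    exact: measurable_funX.
  apply: measurable_funTS; apply: continuous_measurable_fun => x.
  apply: cvgV; last exact: continuous_normal_pdf.
  by rewrite normal_pdfE// mulf_neq0 ?gt_eqF ?normal_peak_gt0 ?expR_gt0.
apply: ae_eq_integral => //; [exact: mf|exact: mf|].
have := is_density_ae_eq Yq Yp.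
by apply: filterS => x /= /(_ I) [->].
Qed.

End density.

Section interpolation.
Context d (T : measurableType d) (R : realType) (P : probability T R).
Variables (X Z : {RV P >-> R}) (t : R).

Definition interpolation (w : T) : R :=
  Num.sqrt t * X w + Num.sqrt (1 - t) * Z w.

Lemma measurable_interpolation : measurable_fun setT interpolation.
Proof. by apply: measurable_funD; apply: measurable_funM. Qed.

HB.instance Definition _ :=
  isMeasurableFun.Build _ _ _ _ interpolation measurable_interpolation.

End interpolation.

(* Main.v *)
(* The proof works in L2(dx) with the Hermite functions
   He_k sqrt(phi) / sqrt(k!): if p is the density of X, then p / sqrt(phi) has
   squared norm chi2(X, Z) + 1 and k-th coefficient E H_k(X) / sqrt(k!), so that
   the case t = 1 is Parseval's identity. For t < 1 the density q of X_t is a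
   Gaussian average of p; Jensen's inequality gives chi2(X_t, Z) <= chi2(X, Z),
   Gaussian integration by parts gives E H_k(X_t) = t^(k/2) E H_k(X), and
   Parseval's identity is applied to q.

   Completeness of the Hermite functions is proved without Fourier analysis. Let
   G have a Gaussian tail and vanishing moments. Expanding exp(- r x^2), for a
   fixed small r, into a power series under the integral and iterating shows that
   the moments of G exp(- k r x^2) vanish for every k. Expanding exp(b x) next,
   G integrates to 0 against Gaussian densities of arbitrary mean and arbitrarily
   small variance, hence over half-lines, and G = 0 a.e. by Lebesgue
   differentiation. *)
Require Import Defs.
From mathcomp Require Import all_boot all_order all_algebra.
From mathcomp Require Import all_classical all_reals all_analysis.
From mathcomp Require Import measurable_realfun ring lra.

Set Implicit Arguments.
Unset Strict Implicit.
Unset Printing Implicit Defensive.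

Import Order.TTheory GRing.Theory Num.Theory.
Import numFieldNormedType.Exports.

Local Open Scope classical_set_scope.
Local Open Scope ring_scope.

(** The obstacle to completeness is domination: the partial sums of the series of exp(h) are bounded
    only by exp |h|, so expanding exp(- b x^2) requires G exp(b x^2) to be integrable. For g in L2
    and G = g sqrt(phi), G exp(x^2 / 8) is integrable, but exponents from 1/4 on are out of reach in
    general. Since the factor exp(- k r x^2) gained so far is at most 1, a step of fixed size r =
    1/16 can be repeated without loss.

    In the smoothing step a = sqrt(t) and s = sqrt(1 - t) satisfy a^2 + s^2 = 1. This makes N(0, 1)
    reversible for the kernel, which drives the Jensen bound, and it makes H_k an eigenfunction with
    eigenvalue a^k. The bound on chi2(X_t, Z) is more than a comparison: it puts q / sqrt(phi) in
    L2, which Parseval's identity needs, and it justifies Fubini's theorem in the computation of the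
    coefficients of q. *)

(** * Square-integrable functions: inner product and completeness of L2 *)

Section square_integrable.
Context d (T : measurableType d) (R : realType).
Variable mu : {measure set T -> \bar R}.

Lemma Lfun2P (f : T -> R) : f \in Lfun mu 2%:E <->
  measurable_fun setT f /\ (\int[mu]_x (f x ^+ 2)%:E < +oo)%E.
Proof.
split=> [f2|[mf f2]].
  split; first by move: f2; rewrite inE => /andP[+ _]; rewrite inE.
  have /integrableP[_] := Lfun2_integrable_sqr f2.
  by under eq_integral do rewrite /= ger0_norm ?sqr_ge0//.
rewrite inE; apply/andP; split; rewrite inE//= /finite_norm unlock /Lnorm.
apply: poweR_lty; rewrite (le_lt_trans _ f2)//.
under eq_integral do rewrite /= powR_mulrn// real_normK ?num_real//.
by [].
Qed.

Lemma Lfun2_measurable (f : T -> R) : f \in Lfun mu 2%:E -> measurable_fun setT f.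
Proof. by case/Lfun2P. Qed.

Lemma Lfun2_integrableM (f g : T -> R) :
  f \in Lfun mu 2%:E -> g \in Lfun mu 2%:E ->
  mu.-integrable setT (EFin \o (fun x => f x * g x)).
Proof. by move=> f2 g2; apply/Lfun1_integrable; exact: Lfun2_mul_Lfun1. Qed.

Definition inner (f g : T -> R) : R := \int[mu]_x (f x * g x).

Lemma innerC f g : inner f g = inner g f.
Proof. by apply: eq_Rintegral => x _; rewrite mulrC. Qed.

Lemma innerDl f g h : f \in Lfun mu 2%:E -> g \in Lfun mu 2%:E ->
  h \in Lfun mu 2%:E -> inner (f + g) h = inner f h + inner g h.
Proof.
move=> f2 g2 h2; rewrite /inner -RintegralD//; [|exact: Lfun2_integrableM..].
by apply: eq_Rintegral => x _; rewrite /= mulrDl.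
Qed.

Lemma innerZl a f g : f \in Lfun mu 2%:E -> g \in Lfun mu 2%:E ->
  inner (a \o* f) g = a * inner f g.
Proof.
move=> f2 g2; rewrite /inner -RintegralZl//; last exact: Lfun2_integrableM.
by apply: eq_Rintegral => x _; rewrite /= mulrAC mulrC mulrA.
Qed.

Lemma Lfun2D f g : f \in Lfun mu 2%:E -> g \in Lfun mu 2%:E ->
  f + g \in Lfun mu 2%:E.
Proof. by apply: (Lfun_addr_closed mu (lee1n 2)).2. Qed.

Lemma Lfun2N f : f \in Lfun mu 2%:E -> - f \in Lfun mu 2%:E.
Proof. exact: Lfun_oppr_closed. Qed.

Lemma Lfun2Z a f : f \in Lfun mu 2%:E -> a \o* f \in Lfun mu 2%:E.
Proof. exact: (Lfun_scale a (ler1n R 2)). Qed.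

Lemma innerNl f g : f \in Lfun mu 2%:E -> g \in Lfun mu 2%:E ->
  inner (- f) g = - inner f g.
Proof.
move=> f2 g2; rewrite -[RHS]mulN1r -innerZl//; congr (inner _ g).
by apply/funext => x; rewrite /= mulrN1.
Qed.

Lemma innerBl f g h : f \in Lfun mu 2%:E -> g \in Lfun mu 2%:E ->
  h \in Lfun mu 2%:E -> inner (f - g) h = inner f h - inner g h.
Proof. by move=> f2 g2 h2; rewrite innerDl ?innerNl ?Lfun2N. Qed.

Lemma Lfun2B f g : f \in Lfun mu 2%:E -> g \in Lfun mu 2%:E ->
  f - g \in Lfun mu 2%:E.
Proof. by move=> f2 g2; rewrite Lfun2D ?Lfun2N. Qed.

Lemma innerBr f g h : f \in Lfun mu 2%:E -> g \in Lfun mu 2%:E ->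
  h \in Lfun mu 2%:E -> inner h (f - g) = inner h f - inner h g.
Proof. by move=> *; rewrite innerC innerBl// ![inner h _]innerC. Qed.

Lemma inner_ge0 f : 0 <= inner f f.
Proof. by apply: Rintegral_ge0 => x _; rewrite -expr2 sqr_ge0. Qed.

Lemma EFin_inner f : f \in Lfun mu 2%:E ->
  (inner f f)%:E = (\int[mu]_x (f x ^+ 2)%:E)%E.
Proof.
move=> f2; rewrite /inner /Rintegral fineK.
  by under eq_integral do rewrite -expr2.
exact: integrable_fin_num (Lfun2_integrableM f2 f2).
Qed.

(** The square [(a * |f| - |g|) ^+ 2 / a] is nonnegative pointwise. The free weight [a] lets this
    bound stand in for the Cauchy-Schwarz inequality without square roots of norms. *)
Lemma inner_le_amgm a f g : f \in Lfun mu 2%:E -> g \in Lfun mu 2%:E -> 0 < a ->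
  `|inner f g| *+ 2 <= a * inner f f + a^-1 * inner g g.
Proof.
move=> f2 g2 a0; have ifg := Lfun2_integrableM f2 g2.
have iff_ := Lfun2_integrableM f2 f2; have igg := Lfun2_integrableM g2 g2.
have iff' : mu.-integrable setT (EFin \o (fun x => a * (f x * f x))).
  exact: (@integrableZl _ _ _ _ _ measurableT a _ iff_).
have igg' : mu.-integrable setT (EFin \o (fun x => a^-1 * (g x * g x))).
  exact: (@integrableZl _ _ _ _ _ measurableT a^-1 _ igg).
have ifg' : mu.-integrable setT (EFin \o (fun x => `|f x * g x|)).
  exact: (integrable_abse ifg).
rewrite /inner -!RintegralZl// -RintegralD// -mulr_natl.
apply: le_trans (_ : 2 * \int[mu]_x `|f x * g x| <= _).
  by rewrite ler_pM2l// le_normr_Rintegral.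
rewrite -RintegralZl//; apply: le_Rintegral => //.
- exact: (@integrableZl _ _ _ _ _ measurableT 2%R _ ifg').
- exact: (integrableD measurableT iff' igg').
move=> x _; rewrite normrM.
rewrite -!expr2 -(real_normK (num_real (f x))) -(real_normK (num_real (g x))).
set u := `|f x|; set v := `|g x|.
have -> : a * u ^+ 2 + a^-1 * v ^+ 2 =
    2 * (u * v) + a^-1 * (a * u - v) ^+ 2.
  by field; rewrite gt_eqF.
by rewrite lerDl mulr_ge0 ?sqr_ge0// invr_ge0 ltW.
Qed.


(* Riesz-Fischer: the weights [2 ^+ j] make the sum of [2 ^+ j * (a j.+1 - a j) ^+ 2]
   integrable, hence finite almost everywhere, and AM-GM then makes
   [series (telescope a)] absolutely convergent at such points. *)
Lemma Lfun2_cauchy_cvg (a : nat -> T -> R) :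
  (forall j, a j \in Lfun mu 2%:E) ->
  (forall i j, (j <= i)%N -> inner (a j - a i) (a j - a i) <= 4^-1 ^+ j) ->
  exists2 g, g \in Lfun mu 2%:E &
    forall j, inner (a j - g) (a j - g) <= 4^-1 ^+ j.
Proof.
move=> a2 aC.
have ma j : measurable_fun setT (a j) by exact: Lfun2_measurable.
pose D j x := 2 ^+ j * (a j x - a j.+1 x) ^+ 2.
have D0 j x : 0 <= D j x by apply: mulr_ge0; [exact: exprn_ge0|exact: sqr_ge0].
have mD j : measurable_fun setT (D j).
  by apply: measurable_funM => //; apply: measurable_funX; exact: measurable_funB.
have intD j : (\int[mu]_x (D j x)%:E <= (2^-1 ^+ j)%:E)%E.
  under eq_integral do rewrite EFinM.
  rewrite ge0_integralZl//=; last 2 first.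
  - by apply/measurable_EFinP; apply: measurable_funX; exact: measurable_funB.
  - by move=> x _; rewrite lee_fin sqr_ge0.
  have := EFin_inner (Lfun2B (a2 j) (a2 j.+1)).
  rewrite {2}/GRing.add/= {2}/GRing.opp/= => <-.
  rewrite -EFinM lee_fin (le_trans (ler_wpM2l _ (aC _ _ (leqnSn j))))//.
  rewrite -exprMn; have -> : 2 * 4^-1 = 2^-1 :> R by field.
  by [].
have mSD : measurable_fun setT (fun x => \sum_(0 <= j <oo) (D j x)%:E)%E.
  apply: ge0_emeasurable_sum => [j x _ _|j _]; first by rewrite lee_fin.
  exact/measurable_EFinP.
have SD : (\int[mu]_x (\sum_(0 <= j <oo) (D j x)%:E) < +oo)%E.
  rewrite integral_nneseries//; last 2 first.
  - by move=> j; exact/measurable_EFinP.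
  - by move=> j x _; rewrite lee_fin.
  apply: le_lt_trans (_ : \sum_(0 <= j <oo) (2^-1 ^+ j : R)%:E < +oo)%E.
    apply: lee_nneseries => // j _ _; apply: integral_ge0 => x _.
    by rewrite lee_fin.
  rewrite (_ : (\sum_(0 <= j <oo) _ = 2%:E)%E) ?ltry//.
  apply/cvg_lim => //.
  have : EFin \o series (geometric (1 : R) 2^-1) @ \oo --> 2%:E.
    apply: cvg_EFin.
      by near=> n.
    have := @cvg_geometric_series R 1 2^-1.
    rewrite (_ : 1 / (1 - 2^-1) = 2); last by field.
    by apply; rewrite ger0_norm ?invf_lt1 ?ltr1n ?invr_ge0.
  apply: cvg_trans; apply: near_eq_cvg; near=> n.
  rewrite /series/= sumEFin; congr EFin; apply: eq_bigr => j _.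
  by rewrite mul1r.
have aeSD : {ae mu, forall x, (\sum_(0 <= j <oo) (D j x)%:E < +oo)%E}.
  have : mu.-integrable setT (fun x => \sum_(0 <= j <oo) (D j x)%:E)%E.
    apply/integrableP; split => //.
    under eq_integral => x _.
      rewrite gee0_abs; last by apply: nneseries_ge0 => j _ _; rewrite lee_fin.
      over.
    exact: SD.
  move/(integrable_ae measurableT); apply: filterS => x /(_ I).
  by rewrite ge0_fin_numE//; apply: nneseries_ge0 => j _ _; rewrite lee_fin.
(* Where the upper limit is infinite, [fine] returns 0. Thus [g] is real-valued and measurable
   everywhere, and it is the limit wherever a finite one exists. *)
pose g x := fine (limn_esup (fun n => (a n x)%:E)).
have mg : measurable_fun setT g.
  apply: measurableT_comp => //; apply: measurable_fun_limn_esup => n.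
  exact/measurable_EFinP.
have ag : {ae mu, forall x, a ^~ x @ \oo --> g x}.
  apply: filterS aeSD => x Dx.
  have cD : cvgn (series (D ^~ x)) by exact: nnseries_is_cvg.
  have ca : cvgn (a ^~ x).
    suff : cvgn (series (telescope (a ^~ x))).
      move=> cs; rewrite (_ : a ^~ x = cst (a 0%N x) + series (telescope (a ^~ x))).
        by apply: is_cvgD => //; exact: is_cvg_cst.
      by apply/funext => n; rewrite [LHS](eq_sum_telescope (a ^~ x)).
    apply: normed_cvg.
    apply: (@series_le_cvg _ _ (fun j => D j x + 2^-1 ^+ j)) => [j|j|j|].
    - exact: normr_ge0.
    - by rewrite addr_ge0// exprn_ge0.
    - have jgt0 : 0 < 2 ^+ j :> R by rewrite exprn_gt0.
      rewrite (_ : [sequence _]_n j = `|a j x - a j.+1 x|); last by rewrite /= distrC.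
      rewrite /D exprVn -(real_normK (num_real (_ - _))).
      set u := `|_|; have u0 : 0 <= u by exact: normr_ge0.
      rewrite -(ler_pM2l jgt0) mulrDr divff ?gt_eqF// mulrA -expr2 -exprMn.
      by set v := _ * u; nra.
    - rewrite (_ : series _ = series (D ^~ x) + series (geometric 1 2^-1)).
        apply: is_cvgD => //; apply: is_cvg_geometric_series.
        by rewrite ger0_norm ?invf_lt1 ?ltr1n ?invr_ge0.
      apply/funext => n; rewrite /series/= fctE big_split/=; congr (_ + _).
      by apply: eq_bigr => j _; rewrite mul1r.
  have ec : (fun n => (a n x)%:E) @ \oo --> (limn (a ^~ x))%:E.
    by apply: cvg_EFin; [exact: nearW|exact: ca].
  by rewrite /g (cvg_limn_einf_sup ec).2.
(* Fatou's lemma: [a j - g] is the a.e. limit of [a j - a i], so its squared norm is at most the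
   lower limit over [i], and eventually [j <= i]. *)
have aint j : (\int[mu]_x ((a j x - g x) ^+ 2)%:E <= (4^-1 ^+ j)%:E)%E.
  have mB i : measurable_fun setT (fun x => ((a j x - a i x) ^+ 2)%:E).
    by apply/measurable_EFinP/measurable_funX; exact: measurable_funB.
  rewrite (@ae_eq_integral _ _ _ mu setT
      (fun x => limn_einf (fun i => ((a j x - a i x) ^+ 2)%:E)))//; last 3 first.
  - by apply/measurable_EFinP/measurable_funX; exact: measurable_funB.
  - apply: (emeasurable_fun_cvg
        (fun n x => einfs (fun i => ((a j x - a i x) ^+ 2)%:E) n)) => [n|x _].
      exact: measurable_fun_einfs.
    by rewrite limn_einf_lim; exact: is_cvg_einfs.
  - apply: filterS ag => x agx _; apply/esym/(cvg_limn_einf_sup _).1.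
    apply: cvg_EFin; first by near=> i.
    have h : (fun i => a j x - a i x) @ \oo --> a j x - g x.
      by apply: cvgB => //; exact: cvg_cst.
    exact: (cvg_comp _ _ h (@exprn_continuous _ 2 _)).
  apply: le_trans (fatou mu measurableT mB _) _ => [i x _|].
    by rewrite lee_fin sqr_ge0.
  rewrite limn_einf_lim; apply: lime_le; first exact: is_cvg_einfs.
  near=> i; have ji : (j <= i)%N by near: i; exact: nbhs_infty_ge.
  apply: le_trans (_ : (\int[mu]_x ((a j x - a i x) ^+ 2)%:E <= _)%E).
    by apply: ereal_inf_lbound; exists i => //=.
  have := EFin_inner (Lfun2B (a2 j) (a2 i)).
  rewrite {2}/GRing.add/= {2}/GRing.opp/= => <-.
  by rewrite lee_fin aC.
have ag2 j : a j - g \in Lfun mu 2%:E.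
  apply/Lfun2P; split; first exact: measurable_funB.
  exact: le_lt_trans (aint j) (ltry _).
exists g => [|j]; last by rewrite -lee_fin EFin_inner// aint.
have -> : g = a 0%N - (a 0%N - g) by apply/funext => x; rewrite !fctE subKr.
exact: Lfun2B.
Unshelve. all: by end_near. Qed.

End square_integrable.

(** * Bessel's inequality and Parseval's identity for a complete orthonormal sequence *)

Section parseval.
Context d (T : measurableType d) (R : realType).
Variable mu : {measure set T -> \bar R}.
Variables (e : nat -> T -> R) (f : T -> R).
Hypothesis e2 : forall k, e k \in Lfun mu 2%:E.
Hypothesis f2 : f \in Lfun mu 2%:E.
Hypothesis eN : forall j k, inner mu (e j) (e k) = (j == k)%:R.

Let c k := inner mu f (e k).

Fixpoint fourier_sum n : T -> R :=
  if n is m.+1 then fourier_sum m + c m \o* e m else cst 0.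

Local Notation S := fourier_sum.

Lemma Lfun2_fourier_sum n : S n \in Lfun mu 2%:E.
Proof.
elim: n => [|n ih]; last by apply: Lfun2D => //; exact: Lfun2Z.
apply/Lfun2P; split => //=.
under eq_integral do rewrite expr0n/=.
by rewrite integral0 ltry.
Qed.

Lemma inner_fourier_sum n g : g \in Lfun mu 2%:E ->
  inner mu (S n) g = \sum_(k < n) c k * inner mu (e k) g.
Proof.
move=> g2; elim: n => [|n ih].
  rewrite big_ord0 /inner; under eq_Rintegral do rewrite /= mul0r.
  by rewrite Rintegral_cst// mul0r.
rewrite big_ord_recr/= -ih innerDl//; [|exact: Lfun2_fourier_sum|exact: Lfun2Z].
by rewrite innerZl.
Qed.

Lemma inner_fourier_sum_basis n k : (k < n)%N -> inner mu (S n) (e k) = c k.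
Proof.
move=> kn; rewrite inner_fourier_sum// (bigD1 (Ordinal kn))//= big1 => [|i].
  by rewrite addr0 eN eqxx mulr1.
by rewrite -val_eqE/= eN => /negbTE->; rewrite mulr0.
Qed.

Let s n := \sum_(k < n) c k ^+ 2.

Lemma inner_fourier_sum_le n m : (n <= m)%N -> inner mu (S n) (S m) = s n.
Proof.
move=> nm; rewrite inner_fourier_sum; last exact: Lfun2_fourier_sum.
apply: eq_bigr => k _; rewrite innerC inner_fourier_sum_basis ?expr2//.
exact: leq_trans nm.
Qed.

Lemma inner_sub_fourier_sum n :
  inner mu (f - S n) (f - S n) = inner mu f f - s n.
Proof.
have Sn2 := Lfun2_fourier_sum n.
rewrite innerBl ?innerBr ?Lfun2B// inner_fourier_sum_le//.
rewrite (innerC _ f (S n)) inner_fourier_sum//.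
rewrite (_ : \sum_(_ < _) _ = s n); first by ring.
by apply: eq_bigr => k _; rewrite innerC expr2.
Qed.

Lemma inner_fourier_sumB n m : (n <= m)%N ->
  inner mu (S n - S m) (S n - S m) = s m - s n.
Proof.
move=> nm; have Sn2 := Lfun2_fourier_sum n; have Sm2 := Lfun2_fourier_sum m.
rewrite innerBl ?innerBr ?Lfun2B// (innerC _ (S m) (S n)).
by rewrite !inner_fourier_sum_le//; ring.
Qed.

Lemma bessel n : s n <= inner mu f f.
Proof. by rewrite -subr_ge0 -inner_sub_fourier_sum inner_ge0. Qed.

(** A subsequence [S (N j)] of the partial sums converges fast enough for [Lfun2_cauchy_cvg]. Its
    limit [g] has the same coefficients as [f], so completeness gives [f = g] a.e., and the gap in
    Bessel's inequality closes along [N j]. *)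
Lemma parseval :
  (forall g, g \in Lfun mu 2%:E -> (forall k, inner mu g (e k) = 0) ->
    g = cst 0 %[ae mu]) ->
  (\int[mu]_x (f x ^+ 2)%:E = \sum_(0 <= k <oo) (c k ^+ 2)%:E)%E.
Proof.
move=> complete.
have snd : {homo s : n m / (n <= m)%N >-> n <= m}.
  apply/nondecreasing_seqP => n; rewrite /s big_ord_recr/= lerDl sqr_ge0//.
have sub : has_ubound (range s).
  by exists (inner mu f f) => _ [n _ <-]; exact: bessel.
have scvg := nondecreasing_is_cvgn snd sub.
set L := limn s in scvg.
have sL n : s n <= L by exact: nondecreasing_cvgn_le.
(* The clause [j <= N j] ensures that each index [k] is eventually below [N j]. *)
have [N NP] : exists N : nat -> nat, forall j,
    (j <= N j)%N /\ forall n, (N j <= n)%N -> L - s n <= 4^-1 ^+ j.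
  suff : forall j, exists N, (j <= N)%N /\ forall n, (N <= n)%N -> L - s n <= 4^-1 ^+ j.
    by move=> /choice[N NP]; exists N.
  move=> j; have e0 : 0 < (4^-1 : R) ^+ j by rewrite exprn_gt0.
  have /cvgrPdist_le/(_ _ e0)[M _ MP] := scvg.
  exists (maxn j M); split => [|n]; first exact: leq_maxl.
  rewrite geq_max => /andP[_ Mn]; have := MP n Mn; apply: le_trans.
  exact: ler_norm.
have Ncauchy i j : (j <= i)%N ->
    inner mu (S (N j) - S (N i)) (S (N j) - S (N i)) <= 4^-1 ^+ j.
  (* [N] need not be monotone. If [N i < N j], the difference is controlled at index [i], and
     [4^-1 ^+ i <= 4^-1 ^+ j]. *)
  move=> ji; have [Nji|/ltnW Nij] := leqP (N j) (N i).
    rewrite inner_fourier_sumB//; apply: le_trans ((NP j).2 _ (leqnn _)).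
    by rewrite lerB.
  have -> : S (N j) - S (N i) = - (S (N i) - S (N j)) by rewrite opprB.
  have N2 : S (N i) - S (N j) \in Lfun mu 2%:E.
    by apply: Lfun2B; exact: Lfun2_fourier_sum.
  rewrite innerNl ?Lfun2N// innerC innerNl ?Lfun2N// opprK inner_fourier_sumB//.
  rewrite (@le_trans _ _ (4^-1 ^+ i))//; last first.
    by rewrite ler_wiXn2l// ?invr_ge0// invf_le1// ler1n.
  by apply: le_trans ((NP i).2 _ (leqnn _)); rewrite lerB.
have [g g2 gS] := Lfun2_cauchy_cvg (fun j => Lfun2_fourier_sum (N j)) Ncauchy.
have fg k : inner mu (f - g) (e k) = 0.
  have small j : (k < j)%N -> `|inner mu (f - g) (e k)| *+ 2 <= 2^-1 ^+ j *+ 2.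
    move=> kj; have SN2 := Lfun2_fourier_sum (N j).
    have kN : (k < N j)%N by exact: leq_trans kj (NP j).1.
    have -> : inner mu (f - g) (e k) = inner mu (S (N j) - g) (e k).
      by rewrite !innerBl// inner_fourier_sum_basis.
    (* The weight [2 ^+ j] balances the two terms of [inner_le_amgm], because
       [2 ^+ j * 4^-1 ^+ j = 2^-1 ^+ j]. *)
    have a0 : 0 < 2 ^+ j :> R by rewrite exprn_gt0.
    apply: le_trans (inner_le_amgm (Lfun2B SN2 g2) (e2 k) a0) _.
    rewrite eN eqxx mulr1 mulr2n -exprVn lerD2r.
    apply: le_trans (ler_wpM2l (ltW a0) (gS j)) _.
    rewrite -exprMn (_ : 2 * 4^-1 = 2^-1 :> R)//.
    by field.
  apply/eqP; rewrite -normr_le0; apply/ler_addgt0Pl => eps eps0; rewrite addr0.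
  have : geometric 1 (2^-1 : R) @ \oo --> 0.
    by apply: cvg_geometric; rewrite ger0_norm ?invf_lt1 ?ltr1n ?invr_ge0.
  move=> /cvgrPdist_le/(_ _ eps0)[M _ MP].
  have := small (maxn k.+1 M) (leq_maxl _ _); rewrite lerMn2r/= => /le_trans; apply.
  have := MP (maxn k.+1 M) (leq_maxr _ _).
  by rewrite /= mul1r sub0r normrN ger0_norm ?exprn_ge0 ?invr_ge0.
have fg0 := complete _ (Lfun2B f2 g2) fg.
have fS j : inner mu f f <= s (N j) + 4^-1 ^+ j.
  rewrite -lerBlDl -inner_sub_fourier_sum; apply: le_trans (gS j).
  rewrite -lee_fin !EFin_inner; [|by apply: Lfun2B => //; exact: Lfun2_fourier_sum..].
  rewrite le_eqVlt; apply/orP; left; apply/eqP; apply: ae_eq_integral => //.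
  - apply/measurable_EFinP/measurable_funX/(@Lfun2_measurable _ _ _ mu).
    by apply: Lfun2B => //; exact: Lfun2_fourier_sum.
  - apply/measurable_EFinP/measurable_funX/(@Lfun2_measurable _ _ _ mu).
    by apply: Lfun2B => //; exact: Lfun2_fourier_sum.
  - apply: filterS fg0 => x /(_ I) /eqP; rewrite subr_eq0 => /eqP fgx _.
    rewrite -[LHS]/(((f x - S (N j) x) ^+ 2)%:E) -[RHS]/(((S (N j) x - g x) ^+ 2)%:E).
    by rewrite fgx -sqrrN opprB.
rewrite -EFin_inner//; apply/esym/cvg_lim => //.
have -> : inner mu f f = L.
  apply/eqP; rewrite eq_le; apply/andP; split; last first.
    by apply: limr_le => //; apply: nearW => n; exact: bessel.
  apply/ler_addgt0Pl => eps eps0.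
  have : geometric 1 (4^-1 : R) @ \oo --> 0.
    by apply: cvg_geometric; rewrite ger0_norm ?invf_lt1 ?ltr1n ?invr_ge0.
  move=> /cvgrPdist_le/(_ _ eps0)[M _ MP].
  apply: le_trans (fS M) _; rewrite addrC lerD//.
  have := MP M (leqnn _).
  by rewrite /= mul1r sub0r normrN ger0_norm ?exprn_ge0 ?invr_ge0.
have : EFin \o s @ \oo --> L%:E by apply: cvg_EFin; [exact: nearW|exact: scvg].
apply: cvg_trans.
apply: near_eq_cvg; near=> n.
by rewrite /= /s -sumEFin big_mkord.
Unshelve. all: by end_near. Qed.

End parseval.

(** * Hermite polynomials as formal polynomials *)

Section hermite_polynomial.
Variable R : realType.
Implicit Types (k : nat) (x : R).

(** The recursion is read off from the derivative of [He_k * exp (- x ^+ 2 / 2)], which equals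
    [- He_k.+1 * exp (- x ^+ 2 / 2)]. *)
Fixpoint hermite_poly k : {poly R} :=
  if k is k'.+1 then 'X * hermite_poly k' - (hermite_poly k')^`() else 1.

(** The Appell property. It turns the defining recursion into the three-term one,
    [He_k.+2 = 'X * He_k.+1 - k.+1 * He_k]. *)
Lemma deriv_hermite_poly k :
  (hermite_poly k.+1)^`() = hermite_poly k *+ k.+1.
Proof.
elim: k => [|k ih]; first by rewrite /= derivC subr0 mulr1 derivX.
rewrite -/hermite_poly [hermite_poly k.+2]/= derivB derivM derivX mul1r.
rewrite -/(hermite_poly k.+1) ih derivMn mulrnAr -addrA -mulrnBl -/hermite_poly.
by rewrite -[_ - _]/(hermite_poly k.+1) -mulrS.
Qed.

Lemma is_derive_expR_poly (p : {poly R}) x :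
  is_derive x 1 (fun y => expR p.[y]) (p^`().[x] * expR p.[x]).
Proof. by rewrite mulrC; exact: (@is_derive1_comp _ expR (horner p)). Qed.

Lemma derive1n_expR_half_sqr k :
  (fun y : R => expR (- (y ^+ 2 / 2)))^`(k)%classic =
  fun y => (-1) ^+ k * (hermite_poly k).[y] * expR (- (y ^+ 2 / 2)).
Proof.
elim: k => [|k ih].
  by apply/funext => x; rewrite derive1n0 expr0 mul1r hornerC mul1r.
rewrite derive1nS ih; apply/funext => x; rewrite derive1E.
pose q : {poly R} := - (2^-1 *: 'X^2).
have qE y : expR (- (y ^+ 2 / 2)) = expR q.[y].
  by rewrite /q hornerN hornerZ hornerXn mulrC.
pose p := (-1) ^+ k *: hermite_poly k.
have -> : (fun y : R => (-1) ^+ k * (hermite_poly k).[y] * expR (- (y ^+ 2 / 2)))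
    = horner p * (fun y => expR q.[y]).
  by apply/funext => y; rewrite qE fctE /p hornerZ.
have dp := is_derive_poly p x; have dq := is_derive_expR_poly q x.
rewrite (@derive_val _ _ _ _ _ _ _ (is_deriveM dp dq)) -qE /p /q.
rewrite derivN !derivZ derivXn /= expr1 hornerN !hornerZ hornerMn hornerX hornerD hornerN hornerM hornerX /GRing.scale/= [(-1) ^+ k.+1]exprS.
by field.
Qed.

Lemma hermiteE k x : hermite k x = (hermite_poly k).[x].
Proof.
rewrite /hermite derive1n_expR_half_sqr !mulrA -signr_odd -expr2 sqrr_sign mul1r.
by rewrite -mulrA -expRD addNr expR0 mulr1.
Qed.

End hermite_polynomial.

(** * Polynomials integrated against Gaussian densities *)

Section gaussian_moments.
Variable R : realType.
Local Notation mu := (@lebesgue_measure R).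
Implicit Types (p q : {poly R}) (m s x : R).

(** Induction on [p] with the rate left free. Each factor ['X] spends half of the rate, through [|x|
    <= 1 + x ^+ 2 <= (1 + (e / 2)^-1) * expR (e / 2 * x ^+ 2)]. *)
Lemma horner_le_expR_sqr p (e : R) : 0 < e ->
  exists2 C, 0 <= C & forall x, `|p.[x]| <= C * expR (e * x ^+ 2).
Proof.
elim/poly_ind: p e => [|p c ih] e e0.
  by exists 0 => // x; rewrite horner0 normr0 mul0r.
have e20 : 0 < e / 2 by rewrite divr_gt0.
have [C C0 pC] := ih _ e20.
exists (C * (1 + (e / 2)^-1) + `|c|) => [|x].
  by rewrite addr_ge0// mulr_ge0// addr_ge0// invr_ge0 ltW.
rewrite hornerMXaddC mulrDl; apply: le_trans (ler_normD _ _) _.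
have E1 : 1 <= expR (e * x ^+ 2).
  by rewrite -expR0 ler_expR mulr_ge0 ?sqr_ge0// ltW.
apply: lerD; last by rewrite ler_peMr.
have -> : e * x ^+ 2 = e / 2 * x ^+ 2 + e / 2 * x ^+ 2 by field.
rewrite expRD normrM mulrACA; apply: ler_pM => //.
set u := e / 2 * x ^+ 2.
have h : 1 + u <= expR u by exact: expR_ge1Dx.
have u0 : 0 <= u by rewrite mulr_ge0 ?sqr_ge0// ltW.
have x2 : x ^+ 2 = (e / 2)^-1 * u by rewrite /u mulrA mulVf ?gt_eqF// mul1r.
apply: le_trans (_ : 1 + x ^+ 2 <= _).
  rewrite -(real_normK (num_real x)); set v := `|x|; have : 0 <= v by exact: normr_ge0.
  by nra.
have i0 : 0 < (e / 2)^-1 by rewrite invr_gt0.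
rewrite x2 mulrDl mul1r; apply: lerD; first by lra.
by apply: ler_wpM2l; lra.
Qed.

Lemma normal_pdf_expR m s x : s != 0 ->
  normal_pdf m s x = normal_peak s * expR (- (x - m) ^+ 2 / (s ^+ 2 *+ 2)).
Proof. by move=> s0; rewrite normal_pdfE. Qed.

(** The polynomial is absorbed at rate [1 / (4 * s ^+ 2)], half of the Gaussian rate
    [1 / (2 * s ^+ 2)]. What remains is the rate of a Gaussian with doubled variance. *)
Lemma horner_normal_pdf_le p m s : 0 < s ->
  exists2 C, 0 <= C & forall x,
    `|p.[x] * normal_pdf m s x| <= C * normal_pdf m (s * Num.sqrt 2) x.
Proof.
move=> s0; have sn0 : s != 0 by rewrite gt_eqF.
have r0 : s * Num.sqrt 2 != 0 by rewrite mulf_neq0// gt_eqF// sqrtr_gt0.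
have e0 : 0 < (s ^+ 2 *+ 4)^-1 by rewrite invr_gt0 pmulrn_lgt0// exprn_gt0.
have [C C0 pC] := horner_le_expR_sqr (p \Po ('X + m%:P)) e0.
exists (C * normal_peak s / normal_peak (s * Num.sqrt 2)) => [|x].
  by rewrite !mulr_ge0 ?invr_ge0 ?normal_peak_ge0.
rewrite normrM (ger0_norm (normal_pdf_ge0 _ _ _)) !normal_pdf_expR//.
rewrite [leRHS]mulrA divfK ?gt_eqF ?normal_peak_gt0//.
have := pC (x - m); rewrite horner_comp hornerD hornerX hornerC subrK => px.
have -> : - (x - m) ^+ 2 / ((s * Num.sqrt 2) ^+ 2 *+ 2) =
   (s ^+ 2 *+ 4)^-1 * (x - m) ^+ 2 + - (x - m) ^+ 2 / (s ^+ 2 *+ 2).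
  by rewrite exprMn sqr_sqrtr//; field.
rewrite expRD; set E1 := expR (- _ / _); set E2 := expR _ in px *.
have -> : C * normal_peak s * (E2 * E1) = normal_peak s * (C * E2 * E1) by ring.
by rewrite mulrCA ler_pM2l ?normal_peak_gt0// ler_pM2r ?expR_gt0.
Qed.

Lemma measurable_horner_normal_pdf p m s :
  measurable_fun setT (fun x => p.[x] * normal_pdf m s x).
Proof. by apply: measurable_funM; [exact: measurable_poly|exact: measurable_normal_pdf]. Qed.

Lemma integrable_horner_normal_pdf p m s : 0 < s ->
  mu.-integrable setT (EFin \o (fun x => p.[x] * normal_pdf m s x)).
Proof.
move=> s0; have [C C0 pC] := horner_normal_pdf_le p m s0.
apply: (le_integrable measurableT _ _
  (integrableZl measurableT C (integrable_normal_pdf m (s * Num.sqrt 2)))).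
  by apply/measurable_EFinP; exact: measurable_horner_normal_pdf.
by move=> x _; rewrite lee_fin; apply: le_trans (pC x) (ler_norm _).
Qed.

Lemma is_derive_normal_pdf m s x : s != 0 ->
  is_derive x 1 (normal_pdf m s) (- (x - m) / s ^+ 2 * normal_pdf m s x).
Proof.
move=> s0; pose q : {poly R} := - (s ^+ 2 *+ 2)^-1 *: ('X - m%:P) ^+ 2.
have qE y : q.[y] = - (y - m) ^+ 2 / (s ^+ 2 *+ 2) by rewrite /q hornerZ horner_exp hornerXsubC !mulNr mulrC.
have NE : normal_pdf m s = cst (normal_peak s) * (fun y => expR q.[y]).
  by apply/funext => y; rewrite normal_pdf_expR// fctE qE.
rewrite NE; apply: is_derive_eq.
rewrite /GRing.scale/= mulr0 addr0 !fctE /q derivZ deriv_exp derivXsubC mul1r.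
rewrite hornerZ hornerMn hornerXsubC hornerZ horner_exp hornerXsubC.
by field.
Qed.

(* The boundary terms of [(p * normal_pdf)'] on [-n, n] are [O(1/n)] because
   [x * p x * normal_pdf x] is bounded. *)
Lemma integral_deriv_horner_normal_pdf p m s : 0 < s ->
  \int[mu]_x ((p^`() - (s ^+ 2)^-1 *: (('X - m%:P) * p)).[x] * normal_pdf m s x) = 0.
Proof.
move=> s0; have sn0 : s != 0 by rewrite gt_eqF.
set q := _ - _; set f := fun x => q.[x] * normal_pdf m s x.
have intf := integrable_horner_normal_pdf q m s0.
pose F : R -> R := horner p * normal_pdf m s.
have dF x : is_derive x 1 F (f x).
  have h := is_deriveM (is_derive_poly p x) (is_derive_normal_pdf m x sn0).
  apply: (@is_derive_eq _ _ _ _ _ _ _ _ h).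
  by rewrite /GRing.scale/= /f /q hornerD hornerN hornerZ hornerM hornerXsubC; field.
have cF : continuous F.
  by move=> x; apply: differentiable_continuous; apply/derivable1_diffP; case: (dF x).
have cf : continuous f.
  move=> x; apply: cvgM; first exact: continuous_horner.
  exact: continuous_normal_pdf.
pose I n : set R := [set` `[- n.+1%:R, n.+1%:R]].
have ftc n : (\int[mu]_(x in I n) (f x)%:E =
    (F n.+1%:R - F (- n.+1%:R))%:E)%E.
  rewrite (@continuous_FTC2 _ f F)//.
  - by rewrite (@lt_trans _ _ 0)// ltrNl oppr0.
  - exact/continuous_subspaceT.
  - split => [x _||]; first by case: (dF x).
      exact/cvg_at_right_filter/cF.
    exact/cvg_at_left_filter/cF.
  - by move=> x _; rewrite derive1E derive_val.
have lim1 : (fun n => \int[mu]_(x in I n) (f x)%:E)%E @ \oo -->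
    (\int[mu]_x (f x)%:E)%E.
  have -> : (fun n => \int[mu]_(x in I n) (f x)%:E)%E =
     (fun n => \int[mu]_x ((EFin \o f) \_ (I n)) x)%E.
    by apply/funext => n; rewrite integral_mkcond.
  have [||||| _ _ //] := @dominated_convergence _ _ _ mu setT measurableT
    (fun n => (EFin \o f) \_ (I n)) (EFin \o f) (abse \o (EFin \o f)).
  - move=> n; apply/(measurable_restrictT _ _).1; first exact: measurable_itv.
    apply/measurable_EFinP/measurable_funTS; exact: measurable_horner_normal_pdf.
  - by apply/measurable_EFinP; exact: measurable_horner_normal_pdf.
  - apply: aeW => x _; apply: cvg_near_cst.
    exists (Num.truncn `|x|) => // n /= nx; rewrite patchE mem_set//= /I/=.
    rewrite in_itv/= -ler_norml ltW// (lt_le_trans (truncnS_gt _))// ler_nat ltnS.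
    by [].
  - exact: integrable_abse.
  - by apply: aeW => x n _; rewrite patchE; case: ifP => _ //=; rewrite ?normr0 lee_fin.
have [C C0 FC] : exists2 C, 0 <= C & forall x, `|x| * `|F x| <= C.
  have [C C0 pC] := horner_normal_pdf_le ('X * p) m s0.
  have r0 : s * Num.sqrt 2 != 0 by rewrite mulf_neq0// gt_eqF// sqrtr_gt0.
  exists (C * normal_peak (s * Num.sqrt 2)).
    by rewrite mulr_ge0 ?normal_peak_ge0.
  move=> x; rewrite -normrM /F fctE mulrA; have := pC x; rewrite !hornerE => /le_trans; apply.
  by rewrite ler_wpM2l// normal_pdf_ub.
have lim2 : (fun n => \int[mu]_(x in I n) (f x)%:E)%E @ \oo -->
    0%E.
  rewrite (funext ftc); apply: cvg_EFin; first by near=> n.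
  have h : (fun n : nat => (2 * C) * n.+1%:R^-1 : R) @ \oo --> 0.
    by rewrite -(mulr0 (2 * C)); apply: cvgM; [exact: cvg_cst|exact: cvg_harmonic].
  apply: norm_cvg0; apply: (squeeze_cvgr _ (cvg_cst 0) h).
  near=> n; rewrite normr_ge0/= ler_pdivlMr//.
  have := FC n.+1%:R; have := FC (- n.+1%:R); rewrite normrN ger0_norm// => h1 h2.
  have := ler_normB (F n.+1%:R) (F (- n.+1%:R)) => h3.
  rewrite mulrC (le_trans (ler_wpM2l _ h3))// mulrDr; lra.
by rewrite /Rintegral (cvg_unique _ lim1 lim2).
Unshelve. all: by end_near. Qed.


(** With a polynomial as argument every integrand is integrable, so linearity carries no side
    condition on [p]. *)
Definition gauss_expect m s p := \int[mu]_x (p.[x] * normal_pdf m s x).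

Local Notation E := gauss_expect.

Lemma gauss_expectD m s p q : 0 < s -> E m s (p + q) = E m s p + E m s q.
Proof.
move=> s0; rewrite /E -RintegralD//; [|exact: integrable_horner_normal_pdf..].
by apply: eq_Rintegral => x _; rewrite hornerD mulrDl.
Qed.

Lemma gauss_expectZ m s a p : 0 < s -> E m s (a *: p) = a * E m s p.
Proof.
move=> s0; rewrite /E -RintegralZl//; last exact: integrable_horner_normal_pdf.
by apply: eq_Rintegral => x _; rewrite hornerZ mulrA.
Qed.

Lemma gauss_expectB m s p q : 0 < s -> E m s (p - q) = E m s p - E m s q.
Proof. by move=> s0; rewrite -scaleN1r gauss_expectD// gauss_expectZ// mulN1r. Qed.

Lemma gauss_expect1 m s : E m s 1 = 1.
Proof.
rewrite /E; under eq_Rintegral do rewrite hornerC mul1r.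
by rewrite /Rintegral integral_normal_pdf.
Qed.

Lemma gauss_expect0 m s : E m s 0 = 0.
Proof.
rewrite /E; under eq_Rintegral do rewrite horner0 mul0r.
by rewrite Rintegral_cst// mul0r.
Qed.

(** Stein's identity: Gaussian integration by parts. *)
Lemma gauss_expectMX m s p : 0 < s ->
  E m s (('X - m%:P) * p) = s ^+ 2 * E m s p^`().
Proof.
move=> s0; have := integral_deriv_horner_normal_pdf p m s0.
rewrite -/(E _ _ _) gauss_expectB// gauss_expectZ// => /eqP.
rewrite subr_eq0 => /eqP ->.
by rewrite mulrA divff ?mul1r// expf_neq0// gt_eqF.
Qed.

(* Gaussian integration by parts turns the recursion defining [hermite_poly]
   into [x * a ^+ k * He_k x - (1 - s ^+ 2) * k * a ^+ k.-1 * He_k.-1 x]. *)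
Lemma gauss_expect_hermite a s x k : 0 < s -> a ^+ 2 + s ^+ 2 = 1 ->
  E (a * x) s (hermite_poly R k) = a ^+ k * (hermite_poly R k).[x].
Proof.
move=> s0 as1.
(* Two consecutive degrees are carried along: the step to [k.+2] uses [k.+1] and, through the
   derivative, [k]. *)
suff : E (a * x) s (hermite_poly R k) = a ^+ k * (hermite_poly R k).[x] /\
       E (a * x) s (hermite_poly R k.+1) = a ^+ k.+1 * (hermite_poly R k.+1).[x].
  by case.
(* The derivative gets the coefficient [s ^+ 2 - 1 = - a ^+ 2], which supplies the two powers of [a]
   by which degrees [k] and [k.+2] differ. *)
have step p : E (a * x) s ('X * p - p^`()) =
    a * x * E (a * x) s p - a ^+ 2 * E (a * x) s p^`().
  have -> : 'X * p - p^`() = ('X - (a * x)%:P) * p + ((a * x) *: p - p^`()).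
    by rewrite -mul_polyC; ring.
  rewrite gauss_expectD// gauss_expectMX// gauss_expectB// gauss_expectZ//.
  have -> : s ^+ 2 = 1 - a ^+ 2 by rewrite -as1; ring.
  by ring.
elim: k => [|k [ih0 ih1]].
  rewrite [hermite_poly R 1]/= step gauss_expect1 derivC.
  by rewrite gauss_expect0 !hornerE; split; ring.
split=> //; rewrite [hermite_poly R k.+2]/= -/(hermite_poly R k.+1) step ih1.
rewrite !deriv_hermite_poly -scaler_nat gauss_expectZ// ih0.
move: (hermite_poly R k.+1) (hermite_poly R k) {ih0 ih1} => p1 p0.
rewrite hornerD hornerN hornerZ hornerM hornerX !exprS.
by ring.
Qed.

(** Under N(0, 1) the operator ['X - d/dx] that raises the degree is adjoint to [d/dx]. Moving it
    across lowers both indices and produces a factor [j.+1], until one polynomial is constant and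
    its derivative vanishes. *)
Lemma gauss_expect_hermiteM j k :
  E 0 1 (hermite_poly R j * hermite_poly R k) = (j == k)%:R * j`!%:R.
Proof.
have step p n : E 0 1 (p * hermite_poly R n.+1) = E 0 1 (p^`() * hermite_poly R n).
  rewrite /= mulrBr gauss_expectB//.
  have -> : p * ('X * hermite_poly R n) = ('X - 0%:P) * (p * hermite_poly R n).
    by rewrite subr0 mulrCA.
  rewrite gauss_expectMX// expr1n mul1r derivM gauss_expectD//.
  by rewrite addrK.
elim: j k => [|j ih] [|k]; first by rewrite mulr1 gauss_expect1 eqxx mulr1.
- by rewrite step derivC mul0r gauss_expect0 mul0r.
- by rewrite mulrC step derivC mul0r gauss_expect0 mul0r.
rewrite step deriv_hermite_poly -scaler_nat -scalerAl gauss_expectZ// ih eqSS.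
by rewrite factS natrM mulrCA.
Qed.

End gaussian_moments.

Lemma EFin_Rintegral d (T : measurableType d) (R : realType)
    (mu : {measure set T -> \bar R}) (f : T -> R) :
  mu.-integrable setT (EFin \o f) ->
  (\int[mu]_x f x)%:E = (\int[mu]_x (f x)%:E)%E.
Proof. by move=> intf; rewrite /Rintegral fineK// integrable_fin_num. Qed.

Lemma Rintegral_eq0 d (T : measurableType d) (R : realType)
    (mu : {measure set T -> \bar R}) (f : T -> R) :
  mu.-integrable setT (EFin \o f) ->
  \int[mu]_x f x = 0 -> (\int[mu]_x (f x)%:E = 0)%E.
Proof. by move=> /EFin_Rintegral <- ->. Qed.

(** * Measurability of Gaussian probabilities in the mean *)

Section normal_prob_mean.
Variable R : realType.
Local Notation mu := (@lebesgue_measure R).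
Implicit Types (x s : R) (A : set R).

Lemma measurable_normal_pdf_mean (a s : R) : s != 0 ->
  measurable_fun setT (fun z : R * R => normal_pdf (a * z.1) s z.2).
Proof.
move=> s0; rewrite (_ : (fun _ => _) = normal_pdf 0 s \o (fun z => z.2 - a * z.1)).
  apply: measurableT_comp; first exact: measurable_normal_pdf.
  by apply: measurable_funB => //; exact: measurable_funM.
by apply/funext => z; rewrite /= !normal_pdf_expR// subr0.
Qed.

Lemma normal_probE x s A :
  (\int[mu]_y (normal_pdf x s y * \1_A y)%:E = normal_prob x s A)%E.
Proof.
rewrite /normal_prob [RHS]integral_mkcond; apply: eq_integral => y _.
rewrite patchE indicE; case: ifP => _; first by rewrite mulr1.
by rewrite mulr0.
Qed.

Lemma measurable_normal_prob_mean (a s : R) A : s != 0 -> measurable A ->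
  measurable_fun setT (fun x => normal_prob (a * x) s A).
Proof.
move=> s0 mA; rewrite (_ : (fun _ => _) =
    fubini_F mu (fun z => (normal_pdf (a * z.1) s z.2 * \1_A z.2)%:E)).
  apply: measurable_fun_fubini_tonelli_F => [|z]; last first.
    by rewrite lee_fin mulr_ge0 ?normal_pdf_ge0.
  apply/measurable_EFinP; apply: measurable_funM.
    exact: measurable_normal_pdf_mean.
  by apply: measurableT_comp => //; exact: measurable_indic.
by apply/funext => x; rewrite -normal_probE.
Qed.

End normal_prob_mean.

(** * A function with a Gaussian tail and vanishing moments is zero almost everywhere *)

Section moment_determinacy.
Variable R : realType.
Local Notation mu := (@lebesgue_measure R).
Variables (G : R -> R) (e : R).
Hypothesis e0 : 0 < e.
Hypothesis mG : measurable_fun setT G.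
Hypothesis intG : mu.-integrable setT (EFin \o (fun x => G x * expR (e * x ^+ 2))).
Hypothesis momG : forall n, \int[mu]_x (G x * x ^+ n) = 0.

(** Partial sums of the exponential series at [h x] are bounded by [expR |h x|], so dominated
    convergence applies term by term. The absolute value in the integrability hypothesis is what
    limits the size of [h]. *)
Lemma Rintegral_expR_series (h F : R -> R) :
  measurable_fun setT h -> measurable_fun setT F ->
  mu.-integrable setT (EFin \o (fun x => F x * expR `|h x|)) ->
  (forall n, \int[mu]_x (F x * h x ^+ n) = 0) ->
  \int[mu]_x (F x * expR (h x)) = 0.
Proof.
move=> mh mF intF F0.
pose f n x := F x * series (exp_coeff (h x)) n.
have mf n : measurable_fun setT (f n).
  apply: measurable_funM => //; rewrite /series/=.
  apply: measurable_sum => i; rewrite /exp_coeff/=.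
  by apply: measurable_funM => //; exact: measurable_funX.
have series_le x n : `|series (exp_coeff (h x)) n| <= expR `|h x|.
  apply: (@le_trans _ _ (series (exp_coeff `|h x|) n)).
    by rewrite -normed_series_exp_coeff; exact: ler_norm_sum.
  apply: nondecreasing_cvgn_le; last exact: is_cvg_series_exp_coeff.
  apply/nondecreasing_seqP => i.
  by rewrite /series/= big_nat_recr//= lerDl exp_coeff_ge0.
have int_term n : mu.-integrable setT (EFin \o (fun x => F x * h x ^+ n)).
  apply: (le_integrable measurableT _ _ (integrableZl measurableT n`!%:R intF)).
    by apply/measurable_EFinP; apply: measurable_funM => //; exact: measurable_funX.
  move=> x _; rewrite lee_fin !normrM normrX mulrCA ler_wpM2l//.
  rewrite normr_nat (ger0_norm (expR_ge0 _)).
  case: n => [|n]; first by rewrite expr0 mul1r -expR0 ler_expR.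
  rewrite -ler_pdivrMl ?ltr0n ?fact_gt0//.
  apply: le_trans (expR_ge1Dxn n (normr_ge0 _)).
  by rewrite mulrC lerDr.
have f_int0 n : (\int[mu]_x (f n x)%:E = 0)%E.
  transitivity (\int[mu]_x (\sum_(0 <= i < n)
      (i`!%:R^-1)%:E * (F x * h x ^+ i)%:E))%E.
    apply: eq_integral => x _; rewrite /f /series/= mulr_sumr -sumEFin.
    by apply: eq_bigr => i _; rewrite exp_coeffE/= -EFinM mulrCA.
  rewrite integral_sum//; last by move=> i; apply: (integrableZl measurableT); exact: int_term.
  apply: big1 => i _; rewrite integralZl//; last exact: int_term.
  by have /= -> := Rintegral_eq0 (int_term i) (F0 i); rewrite mule0.
have [|||||_ _ lim0] := @dominated_convergence _ _ _ mu setT measurableT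
    (fun n => EFin \o f n) (fun x => (F x * expR (h x))%:E)
    (fun x => `|(F x * expR `|h x|)%:E|%E).
- by move=> n; apply/measurable_EFinP; exact: mf.
- apply/measurable_EFinP; apply: measurable_funM => //.
  exact: measurableT_comp.
- apply: aeW => x _; apply: cvg_EFin; first exact: nearW.
  by apply: cvgM; [exact: cvg_cst|exact: is_cvg_series_exp_coeff].
- exact: integrable_abse.
- apply: aeW => x n _; rewrite lee_fin !normrM ler_wpM2l//.
  by rewrite (ger0_norm (expR_ge0 _)).
rewrite /Rintegral (cvg_unique _ lim0 (_ : _ --> 0%E))//.
by under eq_fun do rewrite f_int0; exact: cvg_cst.
Qed.

Lemma integrableM_expR_sqr (w : R -> R) (C : R) : measurable_fun setT w ->
  (forall x, `|w x| <= C * expR (e * x ^+ 2)) ->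
  mu.-integrable setT (EFin \o (fun x => G x * w x)).
Proof.
move=> mw wC.
apply: (le_integrable measurableT _ _ (integrableZl measurableT C intG)).
  by apply/measurable_EFinP; exact: measurable_funM.
move=> x _; rewrite lee_fin !normrM mulrCA ler_wpM2l//.
by apply: le_trans (wC x) _; rewrite -normrM ler_norm.
Qed.

(** One half of the tail exponent [e] pays for [expR |h|] with [h x = - (r * x ^+ 2)], the other
    half for a monomial. *)
Let r := e / 2.
Let r0 : 0 < r. Proof. by rewrite divr_gt0. Qed.

(** Passing from [k] to [k.+1] expands one factor [expR (- (r * x ^+ 2))]; its powers only shift the
    exponent [n]. The accumulated factor is at most 1, so the domination is the same at each
    stage. *)
Lemma moment_expR_sqr k n :
  \int[mu]_x (G x * (x ^+ n * expR (- (k%:R * r * x ^+ 2)))) = 0.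
Proof.
elim: k n => [|k ih] n.
  rewrite -[RHS](momG n); apply: eq_Rintegral => x _.
  by rewrite mul0r mul0r oppr0 expR0 mulr1.
pose w x := x ^+ n * expR (- (k%:R * r * x ^+ 2)).
pose h x := - (r * x ^+ 2).
have mh : measurable_fun setT h.
  by apply: measurableT_comp => //; apply: measurable_funM => //; exact: measurable_funX.
have mw : measurable_fun setT w.
  apply: measurable_funM; first exact: measurable_funX.
  apply: measurableT_comp => //; apply: measurableT_comp => //.
  by apply: measurable_funM => //; exact: measurable_funX.
have hE x : `|h x| = r * x ^+ 2.
  by rewrite normrN ger0_norm// mulr_ge0 ?sqr_ge0// ltW.
have whE x : w x * expR (h x) = x ^+ n * expR (- (k.+1%:R * r * x ^+ 2)).
  by rewrite /w -mulrA -expRD; congr (_ * expR _); rewrite /h -natr1; ring.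
have wE_le x j : `|x ^+ j * expR (- (k%:R * r * x ^+ 2))| <= `|x ^+ j|.
  rewrite normrM (ger0_norm (expR_ge0 _)) ler_piMr// -[leRHS]expR0 ler_expR.
  by rewrite oppr_le0 mulr_ge0 ?sqr_ge0// mulr_ge0// (ltW r0).
have mwj j : measurable_fun setT (fun x : R => x ^+ j * expR (- (k%:R * r * x ^+ 2))).
  apply: measurable_funM; first exact: measurable_funX.
  apply: measurableT_comp => //; apply: measurableT_comp => //.
  by apply: measurable_funM => //; exact: measurable_funX.
transitivity (\int[mu]_x (G x * w x * expR (h x))).
  by apply: eq_Rintegral => x _; rewrite -(whE x) mulrA.
apply: Rintegral_expR_series => //; first exact: measurable_funM.
- have [C C0 nC] := horner_le_expR_sqr 'X^n r0.
  under eq_fun do rewrite -mulrA.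
  apply: (@integrableM_expR_sqr _ C) => [|x].
    by apply: measurable_funM => //; apply: measurableT_comp => //; exact: measurableT_comp.
  rewrite hE normrM (ger0_norm (expR_ge0 (r * _))).
  have := nC x; rewrite hornerXn => nCx.
  have -> : e * x ^+ 2 = r * x ^+ 2 + r * x ^+ 2 by rewrite /r; field.
  rewrite expRD mulrA ler_pM2r ?expR_gt0//; apply: le_trans nCx.
  exact: wE_le.
- move=> j; transitivity ((- r) ^+ j *
    \int[mu]_x (G x * (x ^+ (n + 2 * j) * expR (- (k%:R * r * x ^+ 2))))).
    rewrite -RintegralZl//; last first.
      have [C C0 nC] := horner_le_expR_sqr 'X^(n + 2 * j) e0.
      apply: (@integrableM_expR_sqr _ C) => // x; apply: le_trans (wE_le _ _) _.
      by have := nC x; rewrite hornerXn.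
    apply: eq_Rintegral => x _.
    have -> : h x ^+ j = (- r) ^+ j * x ^+ (2 * j) by rewrite /h -mulNr exprMn -exprM.
    by rewrite exprD /w; ring.
  by rewrite ih mulr0.
Qed.

(** Chosen so that [1 / (2 * s k ^+ 2) = k.+1 * r], an exponent that [moment_expR_sqr] reaches. The
    shift to [k.+1] keeps it positive, and [s k] tends to 0. *)
Let s k : R := (Num.sqrt (k.+1%:R * r *+ 2))^-1.

Let kr0 k : 0 < k.+1%:R * r *+ 2 :> R.
Proof. by rewrite pmulrn_lgt0// mulr_gt0. Qed.

Let s0 k : 0 < s k.
Proof. by rewrite invr_gt0 sqrtr_gt0. Qed.

Let s2 k : s k ^+ 2 = (k.+1%:R * r *+ 2)^-1.
Proof. by rewrite /s exprVn sqr_sqrtr// ltW. Qed.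

(** As a function of its mean [x], the density is a constant times [expR (- (a * x ^+ 2)) * expR (2
    * a * m * x)]. The first factor is covered by [moment_expR_sqr]; the second is expanded in
    powers of [x]. *)
Lemma moment_normal_pdf k m : \int[mu]_x (G x * normal_pdf x (s k) m) = 0.
Proof.
set a := k.+1%:R * r; have a0 : 0 < a by rewrite mulr_gt0.
have NE x : normal_pdf x (s k) m = normal_peak (s k) * expR (- (a * m ^+ 2)) *
    (expR (- (a * x ^+ 2)) * expR (2 * a * m * x)).
  rewrite normal_pdf_expR ?gt_eqF//  s2 -mulrA -!expRD; congr (_ * expR _).
  rewrite -/a; field.
  by rewrite gt_eqF.
have mE : measurable_fun setT (fun x : R => expR (- (a * x ^+ 2))).
  apply: measurableT_comp => //; apply: measurableT_comp => //.
  by apply: measurable_funM => //; exact: measurable_funX.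
have E1 x : `|expR (- (a * x ^+ 2))| <= 1.
  rewrite ger0_norm ?expR_ge0// -[leRHS]expR0 ler_expR.
  by rewrite oppr_le0 mulr_ge0 ?sqr_ge0// (ltW a0).
pose c := 2 * a * m.
(* By AM-GM a linear exponent, whatever the size of [c], costs only a constant against the tail
   [e * x ^+ 2]. *)
have cx x : `|c * x| <= c ^+ 2 / (4 * e) + e * x ^+ 2.
  rewrite normrM -(real_normK (num_real c)) -(real_normK (num_real x)).
  set u := `|c|; set v := `|x|.
  have -> : u ^+ 2 / (4 * e) + e * v ^+ 2 = u * v + (u / (2 * e) - v) ^+ 2 * e.
    by field; rewrite gt_eqF.
  by rewrite lerDl mulr_ge0 ?sqr_ge0// ltW.
have mc : measurable_fun setT (fun x : R => c * x) by exact: measurable_funM.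
have intc : mu.-integrable setT
    (EFin \o (fun x => G x * (expR (- (a * x ^+ 2)) * expR `|c * x|))).
  apply: (@integrableM_expR_sqr _ (expR (c ^+ 2 / (4 * e)))) => [|x].
    apply: measurable_funM => //; apply: measurableT_comp => //.
    exact: measurableT_comp.
  rewrite normrM -expRD -[leRHS]mul1r; apply: ler_pM => //.
  by rewrite ger0_norm ?expR_ge0// ler_expR.
have intc' : mu.-integrable setT
    (EFin \o (fun x => G x * (expR (- (a * x ^+ 2)) * expR (c * x)))).
  apply: (@integrableM_expR_sqr _ (expR (c ^+ 2 / (4 * e)))) => [|x].
    by apply: measurable_funM => //; exact: measurableT_comp.
  rewrite normrM -expRD -[leRHS]mul1r; apply: ler_pM => //.
  by rewrite ger0_norm ?expR_ge0// ler_expR (le_trans (ler_norm _)).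
transitivity (normal_peak (s k) * expR (- (a * m ^+ 2)) *
    \int[mu]_x (G x * (expR (- (a * x ^+ 2)) * expR (c * x)))).
  rewrite -RintegralZl//; apply: eq_Rintegral => x _.
  by rewrite NE mulrCA.
rewrite (_ : \int[mu]_x _ = 0) ?mulr0//.
transitivity (\int[mu]_x (G x * expR (- (a * x ^+ 2)) * expR (c * x))).
  by apply: eq_Rintegral => x _; rewrite mulrA.
apply: Rintegral_expR_series => //; first exact: measurable_funM.
  by under eq_fun do rewrite -mulrA.
move=> j; transitivity (c ^+ j * \int[mu]_x (G x * (x ^+ j * expR (- (a * x ^+ 2))))).
  rewrite -RintegralZl//; last first.
    have [C C0 nC] := horner_le_expR_sqr 'X^j e0.
    apply: (@integrableM_expR_sqr _ C) => [|x].
      by apply: measurable_funM => //; exact: measurable_funX.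
    rewrite normrM; apply: le_trans (_ : `|x ^+ j| * 1 <= _).
      exact: ler_wpM2l.
    by have := nC x; rewrite hornerXn mulr1.
  by apply: eq_Rintegral => x _; rewrite exprMn; ring.
by rewrite moment_expR_sqr mulr0.
Qed.

(** Chebyshev's inequality; the variance [t ^+ 2] is Stein's identity applied to ['X - x]. *)
Lemma normal_prob_chebyshev x (t eta : R) (A : set R) : 0 < t -> 0 < eta ->
  measurable A -> (forall u, A u -> eta <= `|u - x|) ->
  (normal_prob x t A <= (t ^+ 2 / eta ^+ 2)%:E)%E.
Proof.
move=> t0 eta0 mA Aeta; rewrite /normal_prob.
pose p : {poly R} := (eta ^+ 2)^-1 *: (('X - x%:P) * ('X - x%:P)).
have -> : t ^+ 2 / eta ^+ 2 = gauss_expect x t p.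
  rewrite /p gauss_expectZ// gauss_expectMX// derivXsubC gauss_expect1 mulr1.
  by rewrite mulrC.
have pE u : p.[u] = (u - x) ^+ 2 / eta ^+ 2.
  by rewrite /p hornerZ hornerM hornerXsubC mulrC expr2.
rewrite /gauss_expect /Rintegral fineK; last first.
  by apply: integrable_fin_num => //; exact: integrable_horner_normal_pdf.
have p0 u : 0 <= p.[u] by rewrite pE divr_ge0 ?sqr_ge0.
have mp : measurable_fun setT (fun u => (p.[u] * normal_pdf x t u)%:E).
  by apply/measurable_EFinP; exact: measurable_horner_normal_pdf.
apply: (@le_trans _ _ (\int[mu]_(u in A) (p.[u] * normal_pdf x t u)%:E)%E).
  apply: ge0_le_integral => //.
  - by move=> u _; rewrite lee_fin normal_pdf_ge0.
  - by apply/measurable_EFinP/measurable_funTS; exact: measurable_normal_pdf.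
  - exact: measurable_funTS.
  - move=> u /Aeta etau; rewrite lee_fin ler_peMl ?normal_pdf_ge0// pE.
    rewrite ler_pdivlMr ?exprn_gt0// mul1r -[leRHS]real_normK ?num_real//.
    by rewrite ler_pXn2r ?nnegrE// ltW.
apply: ge0_subset_integral => // u _.
by rewrite lee_fin mulr_ge0 ?normal_pdf_ge0.
Qed.


Let intG1 : mu.-integrable setT (EFin \o G).
Proof.
have := @integrableM_expR_sqr (cst 1) 1 (measurable_cst _).
rewrite (_ : (fun x => G x * cst 1 x) = G); last by apply/funext => x; rewrite /= mulr1.
apply=> x; rewrite normr1 mul1r -[leLHS]expR0 ler_expR mulr_ge0 ?sqr_ge0//.
exact: ltW.
Qed.

Let measurable_normal_prob_s k (A : set R) : measurable A ->
  measurable_fun setT (fun x => normal_prob x (s k) A).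
Proof.
move=> mA; have sn0 : s k != 0 by rewrite gt_eqF.
have := measurable_normal_prob_mean 1 sn0 mA.
by under eq_fun do rewrite mul1r.
Qed.

(* Averaging [moment_normal_pdf] over the mean [m <= c]. *)
Lemma moment_normal_prob k c :
  (\int[mu]_x ((G x)%:E * normal_prob x (s k) `]-oo, c]) = 0)%E.
Proof.
set A : set R := `]-oo, c]%classic.
pose f (z : R * R) : R := G z.1 * (normal_pdf z.1 (s k) z.2 * \1_A z.2).
have mA : measurable A by exact: measurable_itv.
have m1A : measurable_fun setT (\1_A : R -> R) by exact: measurable_indic.
have mN : measurable_fun setT (fun z : R * R => normal_pdf z.1 (s k) z.2).
  have := @measurable_normal_pdf_mean R 1 (s k); rewrite gt_eqF// => /(_ isT).
  by under eq_fun do rewrite mul1r.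
have mf : measurable_fun setT (EFin \o f).
  apply/measurable_EFinP; apply: measurable_funM.
    by apply: measurableT_comp => //.
  apply: measurable_funM => //; apply: measurableT_comp => //.
have f_ge0 x y : (0 <= (normal_pdf x (s k) y * \1_A y)%:E :> \bar R)%E.
  by rewrite lee_fin mulr_ge0 ?normal_pdf_ge0.
have mNA x : measurable_fun setT (fun y => (normal_pdf x (s k) y * \1_A y)%:E).
  apply/measurable_EFinP; apply: measurable_funM => //.
  exact: measurable_normal_pdf.
have NA x := normal_probE x (s k) A.
have fE x : (\int[mu]_y `|(EFin \o f) (x, y)| = `|G x|%:E * normal_prob x (s k) A)%E.
  rewrite -NA -ge0_integralZl//; last exact: mNA.
  by apply: eq_integral => y _; rewrite /f /= normrM EFinM (ger0_norm (f_ge0 x y)).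
have mNx := measurable_normal_prob_s k mA.
have intf : (mu \x mu)%E.-integrable setT (EFin \o f).
  apply/integrable12ltyP => //.
  under eq_integral do rewrite fE.
  have /integrableP[mG1] := intG1; apply: le_lt_trans.
  apply: ge0_le_integral => //.
  - by move=> x _; rewrite mule_ge0.
  - by apply: emeasurable_funM => //; apply/measurable_EFinP; exact: measurableT_comp.
  - exact: measurableT_comp.
  - by move=> x _; rewrite -[leRHS]mule1 lee_wpmul2l// probability_le1.
have := Fubini intf.
have -> : (\int[mu]_x \int[mu]_y (EFin \o f) (x, y) =
    \int[mu]_x ((G x)%:E * normal_prob x (s k) A))%E.
  apply: eq_integral => x _; rewrite -NA -integralZl//.
  apply/integrableP; split; first exact: mNA.
  under eq_integral do rewrite gee0_abs//.
  by rewrite NA (le_lt_trans (probability_le1 _ _)) ?ltry.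
move=> ->; apply: integral0_eq => y _.
have GN0 := moment_normal_pdf k y.
have iGN : mu.-integrable setT (EFin \o (fun x => G x * normal_pdf x (s k) y)).
  apply: (le_integrable measurableT _ _ (integrableZl measurableT (normal_peak (s k)) intG1)).
    apply/measurable_EFinP; apply: measurable_funM => //.
    exact: (measurable_fun_pair1 y mN).
  move=> x _; rewrite lee_fin !normrM mulrC ler_wpM2r// ger0_norm ?normal_pdf_ge0//.
  by rewrite ger0_norm ?normal_peak_ge0// normal_pdf_ub// gt_eqF.
transitivity (\int[mu]_x ((\1_A y)%:E * (G x * normal_pdf x (s k) y)%:E))%E.
  by apply: eq_integral => x _; rewrite /= /f /= -EFinM mulrA mulrC.
by rewrite integralZl//; have /= -> := Rintegral_eq0 iGN GN0; rewrite mule0.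
Qed.

Let s_cvg0 (eta : R) : 0 < eta -> (fun k => s k ^+ 2 / eta ^+ 2) @ \oo --> 0.
Proof.
move=> eta0.
have -> : (fun k => s k ^+ 2 / eta ^+ 2) =
    (fun k => (r *+ 2 * eta ^+ 2)^-1 * k.+1%:R^-1).
  apply/funext => k; rewrite s2 -invfM -!invfM; congr (_^-1).
  by rewrite -mulrnAr; ring.
rewrite -(mulr0 (r *+ 2 * eta ^+ 2)^-1); apply: cvgM; first exact: cvg_cst.
exact: cvg_harmonic.
Qed.

(** Off [c] the distance to the boundary is positive and Chebyshev's bound tends to 0. At [x = c]
    the probability is constantly 1/2, so that point is excluded; it forms a null set. *)
Lemma normal_prob_cvg_indic c x : x != c ->
  normal_prob x (s k) `]-oo, c] @[k --> \oo] --> (\1_`]-oo, c] x)%:E.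
Proof.
move=> xc; pose eta := `|x - c|; have eta0 : 0 < eta by rewrite normr_gt0 subr_eq0.
set A : set R := `]-oo, c]%classic.
have mA : measurable A by exact: measurable_itv.
have [cx|xc'] := ltP c x.
  have -> : \1_A x = 0 :> R.
    rewrite indicE memNset// /A/= in_itv/=; apply/negP.
    by rewrite -ltNge.
  apply: (@squeeze_cvge _ _ _ _ (cst 0%E) _ (fun k => (s k ^+ 2 / eta ^+ 2)%:E)).
  - near=> k; rewrite measure_ge0/=; apply: normal_prob_chebyshev => // u.
    rewrite /A/= in_itv/= => uc; rewrite /eta ger0_norm ?subr_ge0 ?(ltW cx)//.
    by rewrite distrC (le_trans _ (ler_norm _))// lerD2l lerN2.
  - exact: cvg_cst.
  - by apply: cvg_EFin; [exact: nearW|exact: s_cvg0].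
have {}xc' : x < c by rewrite lt_neqAle xc.
have -> : \1_A x = 1 :> R by rewrite indicE mem_set// /A/= in_itv/= ltW.
apply: (@squeeze_cvge _ _ _ _ (fun k => (1 - s k ^+ 2 / eta ^+ 2)%:E) _ (cst 1%E)).
- near=> k; rewrite probability_le1// andbT.
  have -> : normal_prob x (s k) A = (1 - normal_prob x (s k) (~` A))%E.
    by rewrite -probability_setC ?setCK//; exact: measurableC.
  rewrite EFinB leeB//; apply: normal_prob_chebyshev => //; first exact: measurableC.
  move=> u; rewrite /A/= in_itv/= => /negP; rewrite -ltNge => cu.
  rewrite /eta distrC ger0_norm ?subr_ge0 ?(ltW xc')//.
  by rewrite (le_trans _ (ler_norm _))// lerD2r ltW.
- apply: cvg_EFin; first exact: nearW.
  rewrite -[X in _ --> X]subr0; apply: cvgB; [exact: cvg_cst|exact: s_cvg0].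
- exact: cvg_cst.
Unshelve. all: by end_near. Qed.

Lemma moment_determinacy : G = cst 0 %[ae mu].
Proof.
have G0 c : \int[mu]_(x in `]-oo, c]) G x = 0.
  set A : set R := `]-oo, c]%classic.
  have mA : measurable A by exact: measurable_itv.
  have [||||| _ _ lim0] := @dominated_convergence _ _ _ mu setT measurableT
    (fun k x => (G x)%:E * normal_prob x (s k) A)%E
    (fun x => (G x * \1_A x)%:E) (abse \o (EFin \o G)).
  - move=> k; apply: emeasurable_funM; first exact/measurable_EFinP.
    exact: measurable_normal_prob_s.
  - by apply/measurable_EFinP; apply: measurable_funM => //.
  - exists [set c]; split; [exact: measurable_set1|exact: lebesgue_measure_set1|].
    move=> x /= xc; apply: contrapT => /eqP xc'; apply: xc => _.
    rewrite EFinM; apply: cvgeM => //.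
    + exact: cvg_cst.
    + exact: normal_prob_cvg_indic.
  - exact: integrable_abse.
  - apply: aeW => x k _; rewrite abseM (gee0_abs (measure_ge0 _ _)).
    by rewrite -[leRHS]mule1 lee_wpmul2l// probability_le1.
  rewrite Rintegral_mkcond.
  transitivity (\int[mu]_x (G x * \1_A x)).
    apply: eq_Rintegral => x _; rewrite patchE indicE; case: ifP => _.
      by rewrite mulr1.
    by rewrite mulr0.
  rewrite /Rintegral (cvg_unique _ lim0 (_ : _ --> 0%E))//.
  by under eq_fun do rewrite moment_normal_prob; exact: cvg_cst.
have locG : locally_integrable setT G by exact: open_integrable_locally openT intG1.
have iG c : mu.-integrable `]-oo, c] (EFin \o G).
  exact: integrableS measurableT _ _ intG1.
(* The primitive of [G] from minus infinity has derivative [G] a.e., and by [G0] it is identically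
   0. *)
have := FTC1Ny iG locG.
apply: filterS; first exact: (ae_filter_ringOfSetsType mu).
move=> x [_ <-] _.
rewrite (_ : (fun y => _) = cst 0); last by apply/funext => y; rewrite G0.
by rewrite derive1_cst.
Qed.

End moment_determinacy.

(** * The Hermite functions as a complete orthonormal sequence in L2(dx) *)

Section hermite_basis.
Variable R : realType.
Local Notation mu := (@lebesgue_measure R).
Implicit Types (p : {poly R}) (x : R) (f g : R -> R).

Local Notation phi := (@normal_pdf R 0 1).
Local Notation He := (hermite_poly R).

Lemma normal_pdf01_gt0 x : 0 < phi x.
Proof. by rewrite normal_pdf_expR// mulr_gt0 ?normal_peak_gt0 ?expR_gt0. Qed.

Definition sqrt_normal_pdf x : R := Num.sqrt (phi x).

Local Notation rphi := sqrt_normal_pdf.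

Lemma sqrt_normal_pdf_gt0 x : 0 < rphi x.
Proof. by rewrite sqrtr_gt0 normal_pdf01_gt0. Qed.

Lemma sqr_sqrt_normal_pdf x : rphi x ^+ 2 = phi x.
Proof. by rewrite sqr_sqrtr// ltW// normal_pdf01_gt0. Qed.

Lemma continuous_sqrt_normal_pdf : continuous rphi.
Proof.
move=> x; apply: (cvg_comp phi Num.sqrt); first exact: continuous_normal_pdf.
exact: sqrt_continuous.
Qed.

Lemma measurable_sqrt_normal_pdf : measurable_fun setT rphi.
Proof. exact: continuous_measurable_fun continuous_sqrt_normal_pdf. Qed.

Lemma Lfun2_horner_sqrt_normal_pdf p : (fun x => p.[x] * rphi x) \in Lfun mu 2%:E.
Proof.
apply/Lfun2P; split.
  apply: measurable_funM; first exact: measurable_poly.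
  exact: measurable_sqrt_normal_pdf.
have /integrableP[_] := integrable_horner_normal_pdf (p * p) 0 (@ltr01 R).
apply: le_lt_trans; rewrite le_eqVlt; apply/orP; left; apply/eqP.
apply: eq_integral => x _ /=.
rewrite exprMn sqr_sqrt_normal_pdf hornerM -expr2 ger0_norm//.
by rewrite mulr_ge0 ?sqr_ge0// normal_pdf_ge0.
Qed.

(** The normalising constant sits inside the polynomial, so that facts about [p.[x] *
    sqrt_normal_pdf x] apply directly. *)
Definition hermite_fun k x : R := ((Num.sqrt k`!%:R)^-1 *: He k).[x] * rphi x.

Lemma Lfun2_hermite_fun k : hermite_fun k \in Lfun mu 2%:E.
Proof. exact: Lfun2_horner_sqrt_normal_pdf. Qed.

Lemma hermite_fun_orthonormal j k :
  inner mu (hermite_fun j) (hermite_fun k) = (j == k)%:R.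
Proof.
transitivity (gauss_expect 0 1
    ((Num.sqrt j`!%:R)^-1 *: ((Num.sqrt k`!%:R)^-1 *: (He j * He k)))).
  apply: eq_Rintegral => x _; rewrite /hermite_fun -sqr_sqrt_normal_pdf.
  by rewrite !hornerZ hornerM; ring.
rewrite !gauss_expectZ// gauss_expect_hermiteM.
have [->|_] := eqVneq j k; last by rewrite !mul0r !mulr0.
have k0 : 0 < Num.sqrt k`!%:R :> R by rewrite sqrtr_gt0 ltr0n fact_gt0.
rewrite mul1r -[X in _ * (_ * X)](@sqr_sqrtr _ k`!%:R)//.
by rewrite expr2 mulKf ?gt_eqF// mulVf ?gt_eqF.
Qed.

Lemma hermite_fun_complete g : g \in Lfun mu 2%:E ->
  (forall k, inner mu g (hermite_fun k) = 0) -> g = cst 0 %[ae mu].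
Proof.
move=> g2 gH; pose G x := g x * rphi x.
have mg := Lfun2_measurable g2.
have ig p : mu.-integrable setT (EFin \o (fun x => g x * (p.[x] * rphi x))).
  exact: Lfun2_integrableM (Lfun2_horner_sqrt_normal_pdf p).
pose L p := \int[mu]_x (g x * (p.[x] * rphi x)).
have LD p q : L (p + q) = L p + L q.
  rewrite /L -RintegralD//; apply: eq_Rintegral => x _.
  by rewrite hornerD mulrDl mulrDr.
have LZ a p : L (a *: p) = a * L p.
  by rewrite /L -RintegralZl//; apply: eq_Rintegral => x _; rewrite hornerZ; ring.
have LH k : L (He k) = 0.
  have k0 : (Num.sqrt k`!%:R)^-1 != 0 :> R.
    by rewrite invr_eq0 gt_eqF// sqrtr_gt0 ltr0n fact_gt0.
  by apply: (mulfI k0); rewrite -LZ mulr0 -(gH k).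
(* Powers of ['X] are introduced by the three-term recursion ['X * He_k.+1 = He_k.+2 + k.+1 * He_k].
   At [k = 0] this gives all monomials, without inverting the change of basis. *)
have LXH n k : L ('X^n * He k) = 0.
  elim: n k => [|n ih] [|k]; rewrite ?expr0 ?mul1r//.
    have -> : 'X^(n.+1) * He 0 = 'X^n * He 1.
      by rewrite /= derivC subr0 !mulr1 exprSr.
    exact: ih.
  have -> : 'X^(n.+1) * He k.+1 = 'X^n * He k.+2 + k.+1%:R *: ('X^n * He k).
    rewrite [He k.+2]/= -/(He k.+1) deriv_hermite_poly exprSr -scaler_nat.
    by rewrite -!mul_polyC; ring.
  by rewrite LD LZ !ih mulr0 addr0.
(* The square root of [phi] decays like [exp (- x ^+ 2 / 4)]. With [e = 1/8] the product still
   decays like [exp (- x ^+ 2 / 8)], whose square is a multiple of the N(0, 2) density. *)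
have e0 : 0 < 8^-1 :> R by rewrite invr_gt0.
have mG : measurable_fun setT G.
  by apply: measurable_funM => //; exact: measurable_sqrt_normal_pdf.
have w2 : (fun x => rphi x * expR (8^-1 * x ^+ 2)) \in Lfun mu 2%:E.
  apply/Lfun2P; split.
    apply: measurable_funM; first exact: measurable_sqrt_normal_pdf.
    by apply: measurableT_comp => //; apply: measurable_funM => //.
  pose C : R := normal_peak 1 / normal_peak (Num.sqrt 2).
  have s0 : Num.sqrt 2 != 0 :> R by rewrite gt_eqF// sqrtr_gt0.
  suff -> : (\int[mu]_x ((rphi x * expR (8^-1 * x ^+ 2)) ^+ 2)%:E =
      \int[mu]_x (C%:E * (normal_pdf 0 (Num.sqrt 2) x)%:E))%E.
    rewrite integralZl//; last exact: integrable_normal_pdf.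
    by rewrite integral_normal_pdf mule1 ltry.
  apply: eq_integral => x _; rewrite -EFinM exprMn sqr_sqrt_normal_pdf; congr EFin.
  rewrite !normal_pdf_expR// /C -expRM_natl [RHS]mulrA divfK ?gt_eqF ?normal_peak_gt0//.
  rewrite -mulrA -expRD; congr (_ * expR _).
  by rewrite sqr_sqrtr// !subr0; field.
have intG : mu.-integrable setT (EFin \o (fun x => G x * expR (8^-1 * x ^+ 2))).
  by rewrite /G; under eq_fun do rewrite -mulrA; exact: Lfun2_integrableM.
have momG n : \int[mu]_x (G x * x ^+ n) = 0.
  rewrite -[RHS](LXH n 0%N) /=; apply: eq_Rintegral => x _.
  by rewrite /G mulr1 hornerXn; ring.
have := moment_determinacy e0 mG intG momG.
apply: filterS; first exact: (ae_filter_ringOfSetsType mu).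
move=> x /[apply] /= /eqP; rewrite mulf_eq0 => /orP[/eqP //|].
by rewrite gt_eqF// sqrt_normal_pdf_gt0.
Qed.

Definition hermite_coeff f k := \int[mu]_x ((He k).[x] * f x).

Section density.
Variable f : R -> R.
Hypothesis mf : measurable_fun setT f.
Hypothesis f2 : (\int[mu]_x (f x ^+ 2 / phi x)%:E < +oo)%E.

Let h x := f x / rphi x.

Let hE x : h x ^+ 2 = f x ^+ 2 / phi x.
Proof. by rewrite /h exprMn exprVn sqr_sqrt_normal_pdf. Qed.

Let h2 : h \in Lfun mu 2%:E.
Proof.
apply/Lfun2P; split; last by under eq_integral do rewrite hE.
apply: measurable_funM => //; apply: continuous_measurable_fun => x.
by apply: cvgV; [rewrite gt_eqF// sqrt_normal_pdf_gt0|exact: continuous_sqrt_normal_pdf].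
Qed.

Lemma integrable_hermite_coeff k :
  mu.-integrable setT (EFin \o (fun x => (He k).[x] * f x)).
Proof.
have := Lfun2_integrableM h2 (Lfun2_horner_sqrt_normal_pdf (He k)).
apply: eq_integrable => // x _ /=; congr EFin; rewrite /h.
by field; rewrite gt_eqF// sqrt_normal_pdf_gt0.
Qed.

Lemma chi2_parseval : (\int[mu]_x (f x ^+ 2 / phi x)%:E =
  \sum_(0 <= k <oo) (k`!%:R^-1 * hermite_coeff f k ^+ 2)%:E)%E.
Proof.
under eq_integral do rewrite -hE.
rewrite (parseval Lfun2_hermite_fun h2 hermite_fun_orthonormal); last first.
  exact: hermite_fun_complete.
apply: eq_eseriesr => k _; congr EFin.
have k0 : 0 < Num.sqrt k`!%:R :> R by rewrite sqrtr_gt0 ltr0n fact_gt0.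
have -> : inner mu h (hermite_fun k) = (Num.sqrt k`!%:R)^-1 * hermite_coeff f k.
  rewrite /hermite_coeff -RintegralZl//; last exact: integrable_hermite_coeff.
  apply: eq_Rintegral => x _; rewrite /h /hermite_fun hornerZ.
  by field; rewrite !gt_eqF// sqrt_normal_pdf_gt0.
by rewrite exprMn exprVn sqr_sqrtr.
Qed.

End density.

End hermite_basis.

(** * Integration against a measure given by a density *)

Section integral_density.
Local Open Scope ereal_scope.
Variables (R : realType) (nu : {measure set R -> \bar R}) (p : R -> R).
Local Notation mu := (@lebesgue_measure R).
Hypothesis mp : measurable_fun setT p.
Hypothesis p0 : forall x, (0 <= p x)%R.
Hypothesis nuE : forall A, measurable A -> nu A = \int[mu]_(x in A) (p x)%:E.

Import HBNNSimple.

Let integral_indic_density (A : set R) (r : R) : measurable A -> (0 <= r)%R ->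
  \int[nu]_x (r * \1_A x)%:E = \int[mu]_x ((r * \1_A x)%:E * (p x)%:E).
Proof.
move=> mA r0.
under eq_integral do rewrite EFinM.
rewrite ge0_integralZl//; last by apply/measurable_EFinP; exact: measurable_indic.
rewrite integral_indic// setIT nuE// integral_mkcond -ge0_integralZl//; last 2 first.
- by apply/(measurable_restrictT _ _).1 => //; apply/measurable_EFinP/measurable_funTS.
- by move=> x _; rewrite patchE; case: ifP => // _; rewrite lee_fin.
apply: eq_integral => x _; rewrite patchE indicE; case: ifP => _.
  by rewrite mulr1.
by rewrite mulr0 mule0 mul0e.
Qed.

Let integral_nnsfun_density (f : {nnsfun R >-> R}) :
  \int[nu]_x (f x)%:E = \int[mu]_x ((f x)%:E * (p x)%:E).
Proof.
have mfr r : measurable_fun setT (fun x : R => (r * \1_(f @^-1` [set r]) x)%:E).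
  exact/measurable_EFinP/measurableT_comp.
have mpE : measurable_fun setT (fun x : R => (p x)%:E) by exact/measurable_EFinP.
under [LHS]eq_integral do rewrite fimfunE -fsumEFin//.
rewrite [LHS]ge0_integral_fsum//; last first.
  by move=> n x _; rewrite EFinM nnfun_muleindic_ge0.
under [RHS]eq_integral.
  move=> x xD; rewrite fimfunE -fsumEFin// ge0_mule_fsuml; last first.
    by move=> r; rewrite EFinM nnfun_muleindic_ge0.
  over.
rewrite [RHS]ge0_integral_fsum//; last 2 first.
- by move=> r; exact: (emeasurable_funM (mfr r) mpE).
- move=> n x _; rewrite mule_ge0//; last by rewrite lee_fin.
  by rewrite EFinM nnfun_muleindic_ge0.
apply: eq_fsbigr => r /set_mem [x _ <-].
exact: integral_indic_density.
Qed.

(** Indicators by [nuE], simple functions by linearity, then monotone convergence along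
    [nnsfun_approx]. *)
Lemma ge0_integral_density (f : R -> \bar R) : measurable_fun setT f ->
  (forall x, 0 <= f x) -> \int[nu]_x f x = \int[mu]_x (f x * (p x)%:E).
Proof.
move=> mf f0; pose f_ := nnsfun_approx measurableT mf.
have mf_ n : measurable_fun setT (fun x : R => (f_ n x)%:E) by exact/measurable_EFinP.
have mpE : measurable_fun setT (fun x : R => (p x)%:E) by exact/measurable_EFinP.
have nd m n x : (m <= n)%N -> (f_ m x)%:E <= (f_ n x)%:E.
  by move=> mn; rewrite lee_fin; exact/lefP/nd_nnsfun_approx.
have cf x : (f_ n x)%:E @[n --> \oo] --> f x by exact: cvg_nnsfun_approx.
have h1 : \int[nu]_x (f_ n x)%:E @[n --> \oo] --> \int[nu]_x f x.
  under eq_integral do rewrite -(cvg_lim (@ereal_hausdorff R) (cf _)).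
  apply: cvg_monotone_convergence => //.
  - by move=> n x _; rewrite lee_fin.
  - by move=> x _ m n; exact: nd.
have h2 : \int[mu]_x ((f_ n x)%:E * (p x)%:E) @[n --> \oo] -->
    \int[mu]_x (f x * (p x)%:E).
  have cfp x : (f_ n x)%:E * (p x)%:E @[n --> \oo] --> f x * (p x)%:E.
    by apply: cvgeZr => //; exact: cf.
  under eq_integral do rewrite -(cvg_lim (@ereal_hausdorff R) (cfp _)).
  apply: cvg_monotone_convergence => //.
  - by move=> n; exact: (emeasurable_funM (mf_ n) mpE).
  - by move=> n x _; rewrite mule_ge0 ?lee_fin.
  - by move=> x _ m n mn; rewrite lee_wpmul2r ?lee_fin//; have := nd m n x mn.
by rewrite -(cvg_lim _ h1)// -(cvg_lim _ h2)//; under eq_fun do rewrite integral_nnsfun_density.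
Qed.

End integral_density.

(** * Affine changes of variable for Lebesgue measure and normal laws *)

Section normal_affine.
Variable R : realType.
Local Notation mu := (@lebesgue_measure R).
Variables (m s : R).
Hypothesis s0 : 0 < s.

Let F (z : R) := m + s * z.

Let mF : @measurable_fun _ _ (measurableTypeR R) (measurableTypeR R) setT F.
Proof. by apply: measurable_funD => //; exact: measurable_funM. Qed.

Let s' : {nonneg R} := NngNum (ltW s0).

Let nu : {measure set (measurableTypeR R) -> \bar R} :=
  mscale s' (measure_function_pushforward__canonical__measure_function_Measure mu mF).

(** The scaled image measure [nu] gives each interval []c, d]] its length, which characterises
    Lebesgue measure. *)
Lemma lebesgue_measure_affine (A : set R) : measurable A ->
  (mu A = s%:E * mu (F @^-1` A))%E.
Proof.
apply: (@lebesgue_measure_unique _ nu) => _ [[c d] _ <-].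
have FE : F @^-1` `]c, d]%classic = `](c - m) / s, (d - m) / s]%classic.
  apply/seteqP; split => z /=; rewrite !in_itv/= /F ltr_pdivrMr// ler_pdivlMr//.
    by rewrite ltrBlDl lerBrDl (mulrC z).
  by rewrite ltrBlDl lerBrDl (mulrC z).
rewrite /nu /= /mscale/= /pushforward FE !lebesgue_measure_itv/= !lte_fin.
rewrite ltr_pM2r ?invr_gt0// ltrD2r; case: ifP => _; last by rewrite mule0.
rewrite -!EFinD -EFinM; congr EFin.
by field; rewrite gt_eqF.
Qed.

Lemma ge0_integral_affine (f : R -> \bar R) : measurable_fun setT f ->
  (forall u, 0 <= f u)%E ->
  (\int[mu]_u f u = s%:E * \int[mu]_z f (m + s * z)%R)%E.
Proof.
move=> mf f0.
transitivity (\int[nu]_u f u)%E.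
  apply: eq_measure_integral => A mA _.
  exact: lebesgue_measure_affine.
rewrite ge0_integral_mscale// ge0_integral_pushforward//.
Qed.

Lemma normal_prob_affine (A : set R) : measurable A ->
  normal_prob 0 1 (F @^-1` A) = normal_prob m s A.
Proof.
move=> mA; rewrite -!normal_probE [RHS]ge0_integral_affine; last 2 first.
- apply/measurable_EFinP; apply: measurable_funM; first exact: measurable_normal_pdf.
  exact: measurable_indic.
- by move=> u; rewrite lee_fin mulr_ge0 ?normal_pdf_ge0.
rewrite -ge0_integralZl//; last 3 first.
- apply/measurable_EFinP; apply: measurable_funM.
    by apply: (measurableT_comp (measurable_normal_pdf _ _)) => //.
  by apply: measurableT_comp => //; exact: measurable_indic.
- by move=> u _; rewrite lee_fin mulr_ge0 ?normal_pdf_ge0.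
- by rewrite lee_fin ltW.
apply: eq_integral => z _; rewrite -EFinM mulrA; congr (_ * _)%:E.
have sn0 : s != 0 by rewrite gt_eqF.
rewrite !normal_pdf_expR// mulrA; congr (_ * expR _).
  rewrite /normal_peak expr1n mul1r -mulrnAr sqrtrM ?sqr_ge0// sqrtr_sqr.
  rewrite gtr0_norm// invfM mulrA divff// mul1r.
  by [].
by field.
Qed.

End normal_affine.

(** * Smoothing a density by a Gaussian kernel *)

Section gauss_kernel.
Variable R : realType.
Implicit Types a s x u : R.

(** The density at [u] of [a * x + s * Z]. For [a ^+ 2 + s ^+ 2 = 1] it is the transition density of
    the Ornstein-Uhlenbeck process. *)
Definition gauss_kernel a s x u := normal_pdf (a * x) s u.

Lemma gauss_kernel_ge0 a s x u : 0 <= gauss_kernel a s x u.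
Proof. exact: normal_pdf_ge0. Qed.

Lemma measurable_gauss_kernel a s : s != 0 ->
  measurable_fun setT (fun z : R * R => gauss_kernel a s z.1 z.2).
Proof. exact: measurable_normal_pdf_mean. Qed.

Lemma measurable_gauss_kernel_swap a s : s != 0 ->
  measurable_fun setT (fun z : R * R => gauss_kernel a s z.2 z.1).
Proof.
move=> s0; rewrite (_ : (fun _ => _) = normal_pdf 0 s \o (fun z => z.1 - a * z.2)).
  apply: measurableT_comp; first exact: measurable_normal_pdf.
  by apply: measurable_funB => //; exact: measurable_funM.
by apply/funext => z; rewrite /gauss_kernel /= !normal_pdf_expR// subr0.
Qed.

Lemma measurable_gauss_kernelr a s x : measurable_fun setT (gauss_kernel a s x).
Proof. exact: measurable_normal_pdf. Qed.

Lemma measurable_gauss_kernell a s u : s != 0 ->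
  measurable_fun setT (gauss_kernel a s ^~ u).
Proof. by move=> s0; exact: (measurable_fun_pair1 u (measurable_gauss_kernel a s0)). Qed.

End gauss_kernel.

Section gaussian_smoothing.
Variable R : realType.
Local Notation mu := (@lebesgue_measure R).
Local Notation phi := (@normal_pdf R 0 1).
Local Notation He := (hermite_poly R).
Variables (p : R -> R) (a s : R).
Hypothesis mp : measurable_fun setT p.
Hypothesis p0 : forall x, 0 <= p x.
Hypothesis intp : mu.-integrable setT (EFin \o p).
Hypothesis s0 : 0 < s.
Hypothesis as1 : a ^+ 2 + s ^+ 2 = 1.

Let sn0 : s != 0. Proof. by rewrite gt_eqF. Qed.

Local Notation K := (gauss_kernel a s).

Let K0 x u : 0 <= K x u. Proof. exact: gauss_kernel_ge0. Qed.

Let mK : measurable_fun setT (fun z : R * R => K z.1 z.2).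
Proof. exact: measurable_gauss_kernel. Qed.

Let mKu u : measurable_fun setT (K ^~ u).
Proof. exact: measurable_gauss_kernell. Qed.

Let mKx x : measurable_fun setT (K x).
Proof. exact: measurable_gauss_kernelr. Qed.

Definition gauss_smooth u : R := \int[mu]_x (p x * K x u).

Local Notation q := gauss_smooth.

Let integrable_pK u : mu.-integrable setT (EFin \o (fun x => p x * K x u)).
Proof.
apply: (le_integrable measurableT _ _ (integrableZl measurableT (normal_peak s) intp)).
  by apply/measurable_EFinP; exact: (measurable_funM mp (mKu u)).
move=> x _; rewrite lee_fin !normrM mulrC ler_wpM2r//.
rewrite ger0_norm// ger0_norm ?normal_peak_ge0//.
exact: normal_pdf_ub.
Qed.

Lemma EFin_gauss_smooth u : (q u)%:E = (\int[mu]_x (p x * K x u)%:E)%E.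
Proof. exact: EFin_Rintegral (integrable_pK u). Qed.

Lemma gauss_smooth_ge0 u : 0 <= q u.
Proof. by apply: Rintegral_ge0 => x _; exact: mulr_ge0. Qed.

Lemma measurable_integral_gauss_kernel (f : R -> R) :
  measurable_fun setT f -> (forall x, 0 <= f x) ->
  measurable_fun setT (fun u => \int[mu]_x (f x * K x u)%:E)%E.
Proof.
move=> mf f0; rewrite (_ : (fun _ => _) =
    fubini_G mu (fun z : R * R => (f z.1 * K z.1 z.2)%:E)); last by [].
apply: measurable_fun_fubini_tonelli_G => [|z]; last by rewrite lee_fin mulr_ge0.
by apply/measurable_EFinP; apply: measurable_funM => //; exact: measurableT_comp.
Qed.

Lemma measurable_gauss_smooth : measurable_fun setT q.
Proof.
apply: (@measurableT_comp _ _ _ _ _ _ (@fine R)) => //.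
exact: measurable_integral_gauss_kernel.
Qed.

(** Tonelli's theorem with free [w] and [f]: an indicator and [p] identify the law with density [q],
    while 1 and [p ^+ 2 / phi] serve the bound on the divergence. *)
Lemma ge0_integral_gauss_smooth (w f : R -> R) :
  measurable_fun setT w -> (forall u, 0 <= w u) ->
  measurable_fun setT f -> (forall x, 0 <= f x) ->
  (\int[mu]_u ((w u)%:E * \int[mu]_x (f x * K x u)%:E) =
   \int[mu]_x ((f x)%:E * \int[mu]_u (w u * K x u)%:E))%E.
Proof.
move=> mw w0 mf f0.
transitivity (\int[mu]_u \int[mu]_x (w u * (f x * K x u))%:E)%E.
  apply: eq_integral => u _.
  have mfK : measurable_fun setT (fun x => (f x * K x u)%:E).
    by apply/measurable_EFinP; exact: measurable_funM.
  have fK0 x : [set: R] x -> (0 <= (f x * K x u)%:E :> \bar R)%E.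
    by move=> _; rewrite lee_fin mulr_ge0.
  by rewrite -(ge0_integralZl mu measurableT mfK fK0) ?lee_fin.
transitivity (\int[mu]_x \int[mu]_u (w u * (f x * K x u))%:E)%E; last first.
  apply: eq_integral => x _.
  have mfK : measurable_fun setT (fun u => (w u * K x u)%:E).
    by apply/measurable_EFinP; exact: measurable_funM.
  have fK0 u : [set: R] u -> (0 <= (w u * K x u)%:E :> \bar R)%E.
    by move=> _; rewrite lee_fin mulr_ge0.
  rewrite -(ge0_integralZl mu measurableT mfK fK0) ?lee_fin//.
  by apply: eq_integral => u _; rewrite -EFinM mulrCA.
apply/esym/(@fubini_tonelli _ _ _ _ R mu mu
  (fun z : R * R => (w z.2 * (f z.1 * K z.1 z.2))%:E)).
  apply/measurable_EFinP; apply: measurable_funM; first exact: measurableT_comp.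
  by apply: measurable_funM => //; exact: measurableT_comp.
by move=> z; rewrite lee_fin !mulr_ge0.
Qed.

Lemma integral_gauss_smooth (A : set R) : measurable A ->
  (\int[mu]_(u in A) (q u)%:E = \int[mu]_x ((p x)%:E * normal_prob (a * x) s A))%E.
Proof.
move=> mA; rewrite integral_mkcond.
transitivity (\int[mu]_u ((\1_A u)%:E * \int[mu]_x (p x * K x u)%:E))%E.
  apply: eq_integral => u _; rewrite -EFin_gauss_smooth patchE indicE.
  by case: ifP => _; rewrite ?mul1e ?mul0e.
have m1 : measurable_fun setT (\1_A : R -> R) by exact: measurable_indic.
have A0 u : 0 <= \1_A u :> R by [].
transitivity (\int[mu]_x ((p x)%:E * \int[mu]_u (\1_A u * K x u)%:E))%E.
  exact: (ge0_integral_gauss_smooth m1 A0 mp p0).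
apply: eq_integral => x _; rewrite -normal_probE; congr (_ * _)%E.
by apply: eq_integral => u _; rewrite mulrC.
Qed.

(** Reversibility: by [as1] both sides are the joint density of two standard normal variables with
    correlation [a], which is symmetric. *)
Lemma normal_pdf_kernel_sym x u : phi x * K x u = phi u * normal_pdf (a * u) s x.
Proof.
rewrite /gauss_kernel !normal_pdf_expR// mulrACA -expRD [RHS]mulrACA -expRD.
congr (_ * expR _).
have s2 : s ^+ 2 = 1 - a ^+ 2 by rewrite -as1; ring.
have s2n0 : 1 - a ^+ 2 != 0 by rewrite -s2 expf_neq0.
by rewrite s2 !subr0 expr1n; field.
Qed.

(* Jensen's inequality, via [2 l p <= p ^+ 2 / phi + l ^+ 2 phi] with
   [l = q u / phi u], the reversibility of the kernel and Tonelli. *)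
Lemma chi2_gauss_smooth_le :
  (\int[mu]_u (q u ^+ 2 / phi u)%:E <= \int[mu]_x (p x ^+ 2 / phi x)%:E)%E.
Proof.
have mphiV : measurable_fun setT (fun x => (phi x)^-1).
  apply: continuous_measurable_fun => x.
  apply: cvgV; first by rewrite gt_eqF// normal_pdf01_gt0.
  exact: continuous_normal_pdf.
have mf : measurable_fun setT (fun x => p x ^+ 2 / phi x).
  by apply: measurable_funM => //; exact: measurable_funX.
have f0 x : 0 <= p x ^+ 2 / phi x.
  by rewrite divr_ge0 ?sqr_ge0// ltW// normal_pdf01_gt0.
pose B u := (\int[mu]_x (p x ^+ 2 / phi x * K x u)%:E)%E.
(* Each [K x] is a probability density in [u], so averaging preserves the total integral. *)
have <- : (\int[mu]_u B u = \int[mu]_x (p x ^+ 2 / phi x)%:E)%E.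
  transitivity (\int[mu]_u ((cst 1%R u)%:E * B u))%E.
    by apply: eq_integral => u _; rewrite mul1e.
  rewrite (ge0_integral_gauss_smooth _ _ mf f0)//; apply: eq_integral => x _.
  under eq_integral do rewrite mul1r.
  by rewrite integral_normal_pdf mule1.
apply: ge0_le_integral => //.
- by move=> u _; rewrite lee_fin divr_ge0 ?sqr_ge0// ltW// normal_pdf01_gt0.
- apply/measurable_EFinP; apply: measurable_funM => //; apply: measurable_funX.
  exact: measurable_gauss_smooth.
- exact: measurable_integral_gauss_kernel.
move=> u _; set l := q u / phi u.
have phiu := normal_pdf01_gt0 u.
have l0 : 0 <= l by rewrite divr_ge0 ?gauss_smooth_ge0// ltW.
(* By reversibility [phi] is invariant under the kernel. *)
have phiK : (\int[mu]_x (phi x * K x u)%:E = (phi u)%:E)%E.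
  under eq_integral do rewrite normal_pdf_kernel_sym EFinM.
  rewrite ge0_integralZl//; last 3 first.
  - by apply/measurable_EFinP; exact: measurable_normal_pdf.
  - by move=> x _; rewrite lee_fin normal_pdf_ge0.
  - by rewrite lee_fin ltW.
  by rewrite integral_normal_pdf mule1.
have : ((2 * l * q u)%:E <= B u + (l ^+ 2 * phi u)%:E)%E.
  have mBu : measurable_fun setT (fun x => (p x ^+ 2 / phi x * K x u)%:E).
    by apply/measurable_EFinP; exact: measurable_funM.
  have mphiK : measurable_fun setT (fun x => (phi x * K x u)%:E).
    apply/measurable_EFinP; apply: measurable_funM => //.
    exact: measurable_normal_pdf.
  have mpK : measurable_fun setT (fun x => (p x * K x u)%:E).
    by apply/measurable_EFinP; exact: measurable_funM.
  have phiK0 x : [set: R] x -> (0 <= (phi x * K x u)%:E :> \bar R)%E.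
    by move=> _; rewrite lee_fin mulr_ge0// normal_pdf_ge0.
  have pK0 x : [set: R] x -> (0 <= (p x * K x u)%:E :> \bar R)%E.
    by move=> _; rewrite lee_fin mulr_ge0.
  have BK0 x : [set: R] x -> (0 <= (p x ^+ 2 / phi x * K x u)%:E :> \bar R)%E.
    by move=> _; rewrite lee_fin mulr_ge0.
  rewrite EFinM EFin_gauss_smooth [(l ^+ 2 * _)%:E]EFinM -phiK.
  have l20 : (0 <= (2 * l)%:E :> \bar R)%E by rewrite lee_fin mulr_ge0.
  rewrite -(ge0_integralZl mu measurableT mpK pK0 l20).
  rewrite -(ge0_integralZl mu measurableT mphiK phiK0) ?lee_fin ?sqr_ge0//.
  have lphiK0 x : [set: R] x -> (0 <= (l ^+ 2)%:E * (phi x * K x u)%:E :> \bar R)%E.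
    by move=> xT; rewrite mule_ge0 ?phiK0// lee_fin sqr_ge0.
  have mlphiK : measurable_fun setT (fun x => (l ^+ 2)%:E * (phi x * K x u)%:E)%E.
    exact: emeasurable_funM.
  rewrite -(ge0_integralD mu measurableT BK0 mBu lphiK0 mlphiK).
  apply: ge0_le_integral => //.
  - by move=> x xT; rewrite mule_ge0 ?pK0// lee_fin mulr_ge0.
  - exact: emeasurable_funM.
  - exact: emeasurable_funD.
  move=> x _; rewrite -!EFinM -EFinD lee_fin mulrA [l ^+ 2 * _]mulrA -mulrDl ler_wpM2r//.
  have phix := normal_pdf01_gt0 x.
  have -> : p x ^+ 2 / phi x + l ^+ 2 * phi x =
      2 * l * p x + (p x - l * phi x) ^+ 2 / phi x.
    by field; rewrite gt_eqF.
  by rewrite lerDl divr_ge0 ?sqr_ge0// ltW.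
(* For this [l] the inequality reads [2 * (q u ^+ 2 / phi u) <= B u + q u ^+ 2 / phi u]. The
   cancelled term is finite even where [B u] is not. *)
have -> : 2 * l * q u = q u ^+ 2 / phi u + q u ^+ 2 / phi u.
  by rewrite /l; field; rewrite gt_eqF.
have -> : l ^+ 2 * phi u = q u ^+ 2 / phi u.
  by rewrite /l; field; rewrite gt_eqF.
by rewrite EFinD leeD2rE.
Qed.

Hypothesis chi2p : (\int[mu]_x (p x ^+ 2 / phi x)%:E < +oo)%E.

(** Exchanging the integrals leaves the expectation of [He k] under the normal law with mean [a * x]
    and deviation [s], which is [a ^+ k * (He k).[x]]. Fubini's theorem applies since [|He k| * q]
    is integrable, [q] having finite divergence. *)
Lemma hermite_coeff_gauss_smooth k :
  hermite_coeff q k = a ^+ k * hermite_coeff p k.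
Proof.
pose f (z : R * R) := (He k).[z.1] * (p z.2 * K z.2 z.1).
have mf : measurable_fun setT (EFin \o f).
  apply/measurable_EFinP; apply: measurable_funM.
    by apply: measurableT_comp => //; exact: measurable_poly.
  apply: measurable_funM; first exact: measurableT_comp.
  exact: measurable_gauss_kernel_swap.
have iq := integrable_hermite_coeff measurable_gauss_smooth
  (le_lt_trans chi2_gauss_smooth_le chi2p) k.
have intf : (mu \x mu)%E.-integrable setT (EFin \o f).
  apply/integrable12ltyP => //.
  have /integrableP[_] := iq; apply: le_lt_trans.
  rewrite le_eqVlt; apply/orP; left; apply/eqP.
  apply: eq_integral => u _.
  rewrite /= normrM EFinM (ger0_norm (gauss_smooth_ge0 u)) EFin_gauss_smooth.
  have mpK : measurable_fun setT (fun x => (p x * K x u)%:E).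
    by apply/measurable_EFinP; exact: measurable_funM.
  have pK0 x : [set: R] x -> (0 <= (p x * K x u)%:E :> \bar R)%E.
    by move=> _; rewrite lee_fin mulr_ge0.
  rewrite -(ge0_integralZl mu measurableT mpK pK0) ?lee_fin//.
  apply: eq_integral => x _; rewrite /f/= normrM EFinM; congr (_ * _%:E)%E.
  by rewrite ger0_norm// mulr_ge0.
apply: EFin_inj; rewrite EFinM [LHS](EFin_Rintegral iq).
rewrite (EFin_Rintegral (integrable_hermite_coeff mp chi2p k)).
transitivity (\int[mu]_u \int[mu]_x (EFin \o f) (u, x))%E.
  apply: eq_integral => u _; rewrite EFinM EFin_gauss_smooth -integralZl//.
  exact: integrable_pK.
rewrite (Fubini intf) -integralZl//; last exact: integrable_hermite_coeff.
apply: eq_integral => x _.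
transitivity (\int[mu]_u ((p x)%:E * ((He k).[u] * K x u)%:E))%E.
  by apply: eq_integral => u _; rewrite /f/= -EFinM mulrCA.
have iH := integrable_horner_normal_pdf (He k) (a * x) s0.
rewrite integralZl//; have /= <- := EFin_Rintegral iH.
rewrite -/(gauss_expect _ _ _) gauss_expect_hermite// -!EFinM; congr EFin.
by ring.
Qed.

End gaussian_smoothing.

(** * Laws of [X] and of the interpolation *)

Section law.
Context d (T : measurableType d) (R : realType) (P : probability T R).
Local Notation mu := (@lebesgue_measure R).
Implicit Types X Y Z : {RV P >-> R}.

(** Positive and negative parts are transported separately; as [p] is nonnegative, multiplying by it
    commutes with taking these parts. *)
Lemma expectation_density X (p h : R -> R) : is_density P X p ->
  measurable_fun setT h -> ('E_P[h \o X] = \int[mu]_x (h x * p x)%:E)%E.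
Proof.
move=> Xp mh; have [mp p0 pE] := Xp; rewrite unlock.
have mhE : measurable_fun setT (EFin \o h) by exact/measurable_EFinP.
rewrite integralE [RHS]integralE; congr (_ - _)%E.
- transitivity (\int[distribution P X]_x (EFin \o h)^\+ x)%E.
    rewrite ge0_integral_distribution; [|exact: measurable_funepos|by []].
    by apply: eq_integral => x _; rewrite funeposE /= funeposE.
  rewrite (@ge0_integral_density _ (distribution P X) p mp p0 pE)//; last exact: measurable_funepos.
  apply: eq_integral => x _; rewrite !funeposE /= -!EFin_max -EFinM.
  by rewrite maxr_pMl// mul0r.
- transitivity (\int[distribution P X]_x (EFin \o h)^\- x)%E.
    rewrite ge0_integral_distribution; [|exact: measurable_funeneg|by []].
    by apply: eq_integral => x _; rewrite funenegE /= funenegE.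
  rewrite (@ge0_integral_density _ (distribution P X) p mp p0 pE)//; last exact: measurable_funeneg.
  apply: eq_integral => x _; rewrite !funenegE /= -!EFin_max -EFinM.
  by rewrite maxr_pMl// mul0r mulNr.
Qed.

Lemma is_density_integrable X p : is_density P X p ->
  mu.-integrable setT (EFin \o p) /\ (\int[mu]_x (p x)%:E = 1)%E.
Proof.
move=> [mp p0 pE]; have := pE setT measurableT; rewrite probability_setT => p1.
split=> //; apply/integrableP; split; first exact/measurable_EFinP.
by under eq_integral do rewrite /= ger0_norm//; rewrite -p1 ltry.
Qed.

(** Independence is agreement on rectangles, and this determines the product measure. *)
Lemma independent_RV_joint X Z (B : set (R * R)) : independent_RV P X Z ->
  measurable B ->
  P ((fun w => (X w, Z w)) @^-1` B) = (distribution P X \x distribution P Z)%E B.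
Proof.
move=> XZ mB.
have mW : measurable_fun setT (fun w => (X w, Z w)).
  exact: measurable_fun_pair.
pose m' := measure_function_pushforward__canonical__measure_function_Measure P mW.
apply/esym; rewrite (@product_measure_unique _ _ _ _ _ _ _ m')//.
Qed.

(** Given [X = x], the interpolation is normal with mean [a * x] and deviation [s], which is
    positive because [t < 1]. Integrating over the law of [X] recovers the mass of [gauss_smooth] on
    [A]. *)
Lemma is_density_interpolation X Z p t : standard_normal P Z ->
  independent_RV P X Z -> is_density P X p -> 0 <= t < 1 ->
  is_density P (interpolation X Z t)
    (gauss_smooth p (Num.sqrt t) (Num.sqrt (1 - t))).
Proof.
move=> ZN XZ Xp /andP[t0 t1].
set a := Num.sqrt t; set s := Num.sqrt (1 - t).
have s0 : 0 < s by rewrite sqrtr_gt0 subr_gt0.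
have [ip p1] := is_density_integrable Xp.
have [mp p0 pE] := Xp.
split; [exact: measurable_gauss_smooth|move=> u; exact: gauss_smooth_ge0|].
move=> A mA; rewrite integral_gauss_smooth//.
pose F (z : R * R) := a * z.1 + s * z.2.
have mF : measurable_fun setT F.
  by apply: measurable_funD; apply: measurable_funM.
have mFA : measurable (F @^-1` A) by rewrite -[_ @^-1` _]setTI; exact: mF.
transitivity ((distribution P X \x distribution P Z)%E (F @^-1` A)).
  by rewrite -independent_RV_joint.
rewrite /product_measure1/=.
transitivity (\int[distribution P X]_x normal_prob (a * x) s A)%E.
  apply: eq_integral => x _ /=.
  rewrite xsectionE -(normal_prob_affine _ s0)//.
  (* The law of [Z] is known on measurable sets only, so the section must be shown measurable. *)
  apply: ZN.
  by rewrite -xsectionE; exact: measurable_xsection.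
rewrite (@ge0_integral_density _ (distribution P X) p mp p0 pE)//; last first.
  by apply: measurable_normal_prob_mean => //; rewrite gt_eqF.
by apply: eq_integral => x _; rewrite muleC.
Qed.

End law.

(** * The divergence along the interpolation *)

Section chi2_interpolation.
Context d (T : measurableType d) (R : realType) (P : probability T R).
Variables (X Z : {RV P >-> R}) (p : R -> R).
Local Notation mu := (@lebesgue_measure R).
Hypothesis Xp : is_density P X p.
Hypothesis chi2p : (\int[mu]_x (p x ^+ 2 / normal_pdf 0 1 x)%:E < +oo)%E.

Lemma expectation_hermite k : ('E_P[hermite k \o X] = (hermite_coeff p k)%:E)%E.
Proof.
have [mp p0 _] := Xp.
have -> : hermite k = horner (hermite_poly R k) by apply/funext => x; rewrite hermiteE.
rewrite (expectation_density Xp); last exact: measurable_poly.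
by rewrite (EFin_Rintegral (integrable_hermite_coeff mp chi2p k)).
Qed.

Lemma interpolation_density t : standard_normal P Z -> independent_RV P X Z ->
  0 <= t <= 1 ->
  exists q, [/\ is_density P (interpolation X Z t) q,
    (\int[mu]_u (q u ^+ 2 / normal_pdf 0 1 u)%:E < +oo)%E &
    forall k, hermite_coeff q k = Num.sqrt t ^+ k * hermite_coeff p k].
Proof.
move=> ZN XZ /andP[t0]; rewrite le_eqVlt => /predU1P[->|t1].
  (* At [t = 1] the kernel degenerates, but the interpolation is [X] itself and [p] serves as its
     density. *)
  exists p; rewrite sqrtr1; split => // [|k]; last by rewrite expr1n mul1r.
  have [mp p0 pE] := Xp; split => // A mA; rewrite -pE//.
  rewrite /distribution /pushforward; congr (P _).
  apply/seteqP; split => w /=; rewrite /interpolation subrr sqrtr0 sqrtr1.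
    by rewrite mul1r mul0r addr0.
  by rewrite mul1r mul0r addr0.
have [ip _] := is_density_integrable Xp; have [mp p0 _] := Xp.
have s0 : 0 < Num.sqrt (1 - t) by rewrite sqrtr_gt0 subr_gt0.
have as1 : Num.sqrt t ^+ 2 + Num.sqrt (1 - t) ^+ 2 = 1.
  by rewrite !sqr_sqrtr ?subr_ge0 ?(ltW t1)// addrC subrK.
exists (gauss_smooth p (Num.sqrt t) (Num.sqrt (1 - t))); split.
- by apply: is_density_interpolation => //; rewrite t0.
- by apply: le_lt_trans chi2p; exact: chi2_gauss_smooth_le.
- by move=> k; exact: hermite_coeff_gauss_smooth.
Qed.

End chi2_interpolation.

Lemma chi2_normal_lty d (T : measurableType d) (R : realType)
    (P : probability T R) (X : {RV P >-> R}) : (chi2_normal P X < +oo)%E ->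
  exists2 p, is_density P X p &
    (\int[lebesgue_measure]_x (p x ^+ 2 / normal_pdf 0 1 x)%:E < +oo)%E.
Proof.
move=> chi2X; have [[p Xp]|noX] := pselect (exists p, is_density P X p).
  exists p => //; move: chi2X; rewrite (chi2_normalE Xp).
  by rewrite lteBlDr// addye.
by move: chi2X; rewrite /chi2_normal; case: pselect.
Qed.

Local Open Scope ereal_scope.

Theorem proposition8p5 (d : measure_display) (T : measurableType d)
    (R : realType) (P : probability T R) (X Z : {RV P >-> R})
    (Z_normal : standard_normal P Z) (XZ_indep : independent_RV P X Z) :
  chi2_normal P X < +oo ->
  forall t : R, (0 <= t <= 1)%R ->
    chi2_normal P (interpolation X Z t) =
    \sum_(1 <= k <oo)
      (t ^+ k / k`!%:R)%:E * ('E_P[hermite k \o X]) ^+ 2.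
Proof.
move=> /chi2_normal_lty[p Xp chi2p] t t01.
have [q [Xq chi2q qE]] := interpolation_density Xp chi2p Z_normal XZ_indep t01.
have [mq q0 _] := Xq; have [_ q1] := is_density_integrable Xq.
rewrite (chi2_normalE Xq) (chi2_parseval mq chi2q) nneseries_recl//; last first.
  by move=> k _; rewrite lee_fin mulr_ge0 ?sqr_ge0// invr_ge0.
(* The zeroth coefficient is the mass of [q]. Its square cancels the [- 1] of the divergence, so the
   series starts at [k = 1]. *)
have -> : hermite_coeff q 0 = 1%R.
  rewrite /hermite_coeff /Rintegral; under eq_integral do rewrite hornerC mul1r.
  by rewrite q1.
rewrite expr1n mulr1 invr1 addeAC subee// add0e.
apply: eq_eseriesr => k _.
rewrite (expectation_hermite Xp chi2p) qE -EFin_expe -EFinM; congr EFin.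
rewrite exprMn -exprM mulnC exprM sqr_sqrtr; last by case/andP: t01.
by rewrite mulrA (mulrC (_^-1)%R).
Qed.
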